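(* Let $R$ be a Koszul algebra. Then for every $i\geq 2$ one has $$H^R_{i,2i-1}=\big(H^R_{1,2}\big)^{i-2}H^R_{2,3}.$$
   Context: $R=S/I$, where $S=k[T_1,\ldots,T_n]$ is a standard graded polynomial ring over a field $k$ and $I\subseteq (T_1,\ldots,T_n)^2$ is a homogeneous ideal. $R$ is a Koszul algebra if $k=R/(T_1,\ldots,T_n)R$ has a linear resolution over $R$, i.e. $\operatorname{Tor}^R_i(k,k)_j=0$ for $i\neq j$. $H^R=H(K^R)\cong \operatorname{Tor}^S(R,k)$ is the Koszul homology algebra of $R$, where $K^R$ is the Koszul complex on the images of $T_1,\ldots,T_n$ in $R$, a DG algebra. $H^R$ is a bigraded graded-commutative $k$-algebra, and $H^R_{i,j}$ denotes its component of homological degree $i$ and internal degree $j$. For subspaces $V,W\subseteq H^R$, the product $VW$ is the $k$-span of all products $vw$ with $v\in V$, $w\in W$; powers of a subspace are defined accordingly, with $V^0=k$. *)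

(* Defs.v *)
From HB Require Import structures.
From mathcomp Require Import all_boot all_order all_algebra.
From mathcomp.classical Require Import boolp.
From mathcomp Require Import mpoly.

Set Implicit Arguments.
Unset Strict Implicit.
Unset Printing Implicit Defensive.

Import GRing.Theory.

Local Open Scope ring_scope.
Local Open Scope quotient_scope.

Section QuotientAlgebra.
Variables (k : fieldType) (n : nat) (I : idealr {mpoly k[n]}).
Local Notation R := {ideal_quot I}.

Definition quot_scale (c : k) (x : R) : R := \pi_R c%:MP * x.

Fact quot_scaleA a b x : quot_scale a (quot_scale b x) = quot_scale (a * b) x.
Proof. by rewrite /quot_scale mulrA -rmorphM -mpolyCM. Qed.

Fact quot_scale1 : left_id 1 quot_scale.
Proof. by move=> x; rewrite /quot_scale mpolyC1 rmorph1 mul1r. Qed.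

Fact quot_scaleDr : right_distributive quot_scale +%R.
Proof. by move=> a x y; rewrite /quot_scale mulrDr. Qed.

Fact quot_scaleDl x : {morph quot_scale^~ x : a b / a + b}.
Proof. by move=> a b; rewrite /quot_scale mpolyCD rmorphD mulrDl. Qed.

HB.instance Definition _ := GRing.Zmodule_isLmodule.Build k R
  quot_scaleA quot_scale1 quot_scaleDr quot_scaleDl.

Fact quot_scalerAl (a : k) (x y : R) : a *: (x * y) = a *: x * y.
Proof. by rewrite /GRing.scale /= /quot_scale mulrA. Qed.

HB.instance Definition _ := GRing.Lmodule_isLalgebra.Build k R quot_scalerAl.

Fact quot_scalerAr (a : k) (x y : R) : a *: (x * y) = x * (a *: y).
Proof. by rewrite /GRing.scale /= /quot_scale mulrCA. Qed.

HB.instance Definition _ := GRing.Lalgebra_isAlgebra.Build k R quot_scalerAr.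

End QuotientAlgebra.

Definition koszul (k : fieldType) (R : comAlgType k) (n : nat)
  (t : 'I_n -> R) : Type := {ffun {set 'I_n} -> R}.

Section KoszulComplex.
Variables (k : fieldType) (R : comAlgType k) (n : nat) (t : 'I_n -> R).
Local Notation K := (koszul t).
Implicit Types (f g h : K) (A B C : {set 'I_n}).

HB.instance Definition _ := GRing.Lmodule.copy K {ffun {set 'I_n} -> R}.

(* [f : koszul t] stands for \sum_A f A e_A, where e_A is the exterior product *)
(* of the e_i, i \in A, in increasing order. Thus e_A e_B is 0 when A and B    *)
(* meet, and is e_(A :|: B) up to the sign of the shuffle otherwise.           *)
Definition inversions A B : nat := \sum_(a in A) \sum_(b in B) (b < a)%N.

Definition ext_sign A B : R :=
  if [disjoint A & B] then (-1) ^+ inversions A B else 0.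

Definition koszul_mul f g : K :=
  [ffun C => \sum_A \sum_B
     (if A :|: B == C then ext_sign A B * (f A * g B) else 0)].

Definition koszul_one : K := [ffun C => (C == set0)%:R].

(* d e_A = \sum_(i in A) +/- t_i e_(A :\ i), the sign being (-1)^#{b in A | b < i} *)
Definition koszul_d f : K :=
  [ffun A : {set 'I_n} => \sum_(i | i \notin A)
     (-1) ^+ inversions [set i] A * (t i * f (i |: A))].

Lemma inversions0l B : inversions set0 B = 0%N.
Proof. by rewrite /inversions big_set0. Qed.

Lemma inversions0r A : inversions A set0 = 0%N.
Proof. by rewrite /inversions big1 // => i _; rewrite big_set0. Qed.

Lemma inversionsUl A B C : [disjoint A & B] ->
  inversions (A :|: B) C = (inversions A C + inversions B C)%N.
Proof.
move=> AB; rewrite /inversions -bigU //; apply: eq_bigl => a.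
by rewrite !inE.
Qed.

Lemma inversionsUr A B C : [disjoint B & C] ->
  inversions A (B :|: C) = (inversions A B + inversions A C)%N.
Proof.
move=> BC; rewrite /inversions -big_split; apply: eq_bigr => a _ /=.
by rewrite -bigU //; apply: eq_bigl => b; rewrite !inE.
Qed.

Lemma ext_signA A B C :
  ext_sign A B * ext_sign (A :|: B) C = ext_sign A (B :|: C) * ext_sign B C.
Proof.
rewrite /ext_sign ![[disjoint _ & _]]disjoints_subset.
rewrite subUset setCU subsetI -!disjoints_subset.
case: (boolP [disjoint A & B]) => AB; case: (boolP [disjoint A & C]) => AC;
  case: (boolP [disjoint B & C]) => BC; rewrite ?(mul0r, mulr0) //=.
by rewrite -!exprD inversionsUl // inversionsUr // !addnA.
Qed.

Fact koszul_mulA : associative koszul_mul.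
Proof.
move=> f g h; apply/ffunP => D; rewrite !ffunE.
transitivity (\sum_A \sum_B \sum_C
  (if A :|: (B :|: C) == D then
     ext_sign A (B :|: C) * ext_sign B C * (f A * (g B * h C)) else 0)).
  apply: eq_bigr => A _.
  transitivity (\sum_E \sum_B \sum_C (if B :|: C == E then
     if A :|: E == D then
      ext_sign A E * ext_sign B C * (f A * (g B * h C)) else 0 else 0)).
    apply: eq_bigr => E _; rewrite ffunE; case: eqP => _; last first.
      by rewrite !big1 // => B _; rewrite big1 // => C _; case: ifP.
    rewrite !mulr_sumr; apply: eq_bigr => B _.
    rewrite !mulr_sumr; apply: eq_bigr => C _.
    case: ifP => _; last by rewrite !mulr0.
    by rewrite -!mulrA; congr (_ * _); rewrite mulrCA.
  rewrite exchange_big; apply: eq_bigr => B _.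
  rewrite exchange_big; apply: eq_bigr => C _.
  by rewrite -big_mkcond (eq_bigl (pred1 (B :|: C))) ?big_pred1_eq.
transitivity (\sum_A \sum_B \sum_C
  (if (A :|: B) :|: C == D then
     ext_sign A B * ext_sign (A :|: B) C * (f A * g B * h C) else 0)).
  apply: eq_bigr => A _; apply: eq_bigr => B _; apply: eq_bigr => C _.
  by rewrite setUA ext_signA !mulrA.
symmetry.
transitivity (\sum_E \sum_A \sum_B \sum_C (if A :|: B == E then
    if E :|: C == D then
      ext_sign A B * ext_sign E C * (f A * g B * h C) else 0 else 0)).
  apply: eq_bigr => E _.
  transitivity (\sum_C \sum_A \sum_B (if A :|: B == E then
     if E :|: C == D then
      ext_sign A B * ext_sign E C * (f A * g B * h C) else 0 else 0)).
    apply: eq_bigr => C _; rewrite ffunE; case: eqP => _; last first.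
      by rewrite !big1 // => A _; rewrite big1 // => B _; case: ifP.
    rewrite mulr_suml mulr_sumr; apply: eq_bigr => A _.
    rewrite mulr_suml mulr_sumr; apply: eq_bigr => B _.
    case: ifP => _; last by rewrite mul0r mulr0.
    by rewrite !mulrA; congr (_ * _ * _ * _); apply: mulrC.
  rewrite exchange_big; apply: eq_bigr => A _.
  by rewrite exchange_big; apply: eq_bigr => B _.
rewrite exchange_big; apply: eq_bigr => A _.
rewrite exchange_big; apply: eq_bigr => B _.
rewrite exchange_big; apply: eq_bigr => C _.
by rewrite -big_mkcond (eq_bigl (pred1 (A :|: B))) ?big_pred1_eq.
Qed.

Fact koszul_mul1l : left_id koszul_one koszul_mul.
Proof.
move=> f; apply/ffunP => C; rewrite ffunE (bigD1 set0) //= [X in _ + X]big1.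
  rewrite addr0 (bigD1 C) //= big1 ?addr0.
    rewrite set0U eqxx ffunE eqxx /ext_sign inversions0l.
    by rewrite disjoints_subset sub0set !mul1r.
  by move=> B nBC; rewrite set0U (negPf nBC).
move=> A nA0; apply: big1 => B _; rewrite ffunE (negPf nA0) mul0r mulr0.
by case: ifP.
Qed.

Fact koszul_mul1r : right_id koszul_one koszul_mul.
Proof.
move=> f; apply/ffunP => C; rewrite ffunE (bigD1 C) //= [X in _ + X]big1.
  rewrite addr0 (bigD1 set0) //= big1 ?addr0.
    rewrite setU0 eqxx ffunE eqxx /ext_sign inversions0r.
    by rewrite disjoint_sym disjoints_subset sub0set mul1r mulr1.
  move=> B nB0; rewrite ffunE (negPf nB0) !mulr0; by case: ifP.
move=> A nAC; apply: big1 => B _; rewrite ffunE.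
by case: (eqVneq B set0) => [->|_]; rewrite ?setU0 ?(negPf nAC) ?mulr0 ?if_same.
Qed.

Fact koszul_mulDl : left_distributive koszul_mul +%R.
Proof.
move=> f g h; apply/ffunP => C; rewrite !ffunE -big_split; apply: eq_bigr => A _.
rewrite -big_split; apply: eq_bigr => B _ /=; rewrite ffunE.
by case: ifP; rewrite ?addr0 // mulrDl mulrDr.
Qed.

Fact koszul_mulDr : right_distributive koszul_mul +%R.
Proof.
move=> f g h; apply/ffunP => C; rewrite !ffunE -big_split; apply: eq_bigr => A _.
rewrite -big_split; apply: eq_bigr => B _ /=; rewrite ffunE.
by case: ifP; rewrite ?addr0 // !mulrDr.
Qed.

Fact koszul_one_neq0 : koszul_one != 0.
Proof.
by apply/eqP => /ffunP /(_ set0) /eqP; rewrite !ffunE eqxx oner_eq0.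
Qed.

HB.instance Definition _ := GRing.Zmodule_isNzRing.Build K
  koszul_mulA koszul_mul1l koszul_mul1r koszul_mulDl koszul_mulDr
  koszul_one_neq0.

Lemma koszul_mulE f g C : (f * g) C = \sum_A \sum_B
  (if A :|: B == C then ext_sign A B * (f A * g B) else 0).
Proof. by rewrite [LHS]ffunE. Qed.

Lemma koszul_addE f g C : (f + g) C = f C + g C.
Proof. exact: ffunE. Qed.

Lemma koszul_scaleE (a : k) f C : (a *: f) C = a *: f C.
Proof. exact: ffunE. Qed.

Fact koszul_scalerAl (a : k) f g : a *: (f * g) = a *: f * g.
Proof.
apply/ffunP => C; rewrite koszul_scaleE !koszul_mulE scaler_sumr.
apply: eq_bigr => A _; rewrite scaler_sumr; apply: eq_bigr => B _.
rewrite koszul_scaleE; case: ifP => _; last by rewrite scaler0.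
by rewrite scalerAr scalerAl.
Qed.

HB.instance Definition _ := GRing.Lmodule_isLalgebra.Build k K koszul_scalerAl.

Fact koszul_scalerAr (a : k) f g : a *: (f * g) = f * (a *: g).
Proof.
apply/ffunP => C; rewrite koszul_scaleE !koszul_mulE scaler_sumr.
apply: eq_bigr => A _; rewrite scaler_sumr; apply: eq_bigr => B _.
rewrite koszul_scaleE; case: ifP => _; last by rewrite scaler0.
by rewrite !scalerAr.
Qed.

HB.instance Definition _ := GRing.Lalgebra_isAlgebra.Build k K koszul_scalerAr.

Fact koszul_d_is_linear : linear koszul_d.
Proof.
move=> a f g; apply/ffunP => A; rewrite koszul_addE koszul_scaleE !ffunE.
rewrite scaler_sumr -big_split; apply: eq_bigr => i _ /=.
by rewrite koszul_addE koszul_scaleE !mulrDr !scalerAr.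
Qed.

HB.instance Definition _ :=
  GRing.isLinear.Build k K K _ koszul_d koszul_d_is_linear.

Definition koszul_gen (i : 'I_n) : K := [ffun A => (A == [set i])%:R].
Local Notation e := koszul_gen.

Definition koszul_rscale (r : R) f : K := [ffun A => r * f A].

Definition koszul_sgn f : K := [ffun A : {set 'I_n} => (-1) ^+ #|A| * f A].

Lemma koszul_rscaleMl r f g :
  koszul_rscale r f * g = koszul_rscale r (f * g).
Proof.
apply/ffunP => C; rewrite [RHS]ffunE !koszul_mulE mulr_sumr.
apply: eq_bigr => A _; rewrite mulr_sumr; apply: eq_bigr => B _.
rewrite ffunE; case: ifP => _; last by rewrite mulr0.
by rewrite -mulrA mulrCA.
Qed.

Lemma koszul_rscaleMr r f g :
  f * koszul_rscale r g = koszul_rscale r (f * g).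
Proof.
apply/ffunP => C; rewrite [RHS]ffunE !koszul_mulE mulr_sumr.
apply: eq_bigr => A _; rewrite mulr_sumr; apply: eq_bigr => B _.
rewrite ffunE; case: ifP => _; last by rewrite mulr0.
by rewrite [RHS]mulrCA; congr (_ * _); apply: mulrCA.
Qed.

Lemma koszul_d_rscale r f :
  koszul_d (koszul_rscale r f) = koszul_rscale r (koszul_d f).
Proof.
apply/ffunP => A; rewrite !ffunE mulr_sumr; apply: eq_bigr => i _.
by rewrite ffunE [RHS]mulrCA; congr (_ * _); apply: mulrCA.
Qed.

Lemma koszul_sgn_rscale r f :
  koszul_sgn (koszul_rscale r f) = koszul_rscale r (koszul_sgn f).
Proof. by apply/ffunP => A; rewrite !ffunE mulrCA. Qed.

Lemma koszul_rscaleD r f g :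
  koszul_rscale r (f + g) = koszul_rscale r f + koszul_rscale r g.
Proof. by apply/ffunP => A; rewrite koszul_addE !ffunE mulrDr. Qed.

Lemma koszul_sgnD f g : koszul_sgn (f + g) = koszul_sgn f + koszul_sgn g.
Proof. by apply/ffunP => A; rewrite koszul_addE !ffunE mulrDr. Qed.

Lemma koszul_sgnK : involutive koszul_sgn.
Proof.
by move=> f; apply/ffunP => A; rewrite !ffunE signrMK.
Qed.

Lemma koszul_genM i f C : (e i * f) C =
  if i \in C then (-1) ^+ inversions [set i] (C :\ i) * f (C :\ i) else 0.
Proof.
rewrite koszul_mulE (bigD1 [set i]) //= [X in _ + X]big1 ?addr0; last first.
  move=> A nA; apply: big1 => B _; rewrite ffunE (negPf nA) mul0r mulr0.
  by rewrite if_same.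
case: ifP => iC.
  rewrite (bigD1 (C :\ i)) //= big1 ?addr0.
    rewrite setD1K // eqxx ffunE eqxx mul1r /ext_sign.
    by rewrite disjoints_subset sub1set !inE eqxx.
  move=> B nB; case: eqP => // iBC; rewrite /ext_sign.
  rewrite disjoints_subset sub1set inE; case: ifP => iB; last by rewrite mul0r.
  by case/negP: nB; rewrite -iBC setU1K.
apply: big1 => B _; case: eqP => // iBC; move: iC.
by rewrite -iBC !inE eqxx.
Qed.

Lemma inversions1U i j C : j \notin C ->
  inversions [set i] (j |: C) = ((j < i) + inversions [set i] C)%N.
Proof. by move=> jC; rewrite inversionsUr ?disjoints_subset ?sub1set ?inE //
  /inversions !big_set1. Qed.

Lemma koszul_d_genM i f :
  koszul_d (e i * f) = koszul_rscale (t i) f - e i * koszul_d f.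
Proof.
apply/ffunP => C; rewrite koszul_addE [LHS]ffunE [X in X + _]ffunE.
rewrite [X in _ + X]ffunE koszul_genM.
case: ifP => iC; last first.
  rewrite oppr0 addr0 (bigD1 i) ?iC //= big1 ?addr0.
    rewrite koszul_genM !inE eqxx setU1K ?iC //= mulrCA.
    by rewrite signrMK.
  move=> j /andP [jC ji]; rewrite koszul_genM !inE eq_sym (negPf ji) iC.
  by rewrite !mulr0.
rewrite [koszul_d f _]ffunE [in RHS](bigD1 i) ?inE ?eqxx //= setD1K // mulrDr signrMK.
rewrite opprD addrA addrN add0r mulr_sumr -sumrN.
apply: eq_big => [j|j jC].
  by rewrite !inE; case: (eqVneq j i) => [->|_]; rewrite ?iC ?andbT.
have ji : j != i by apply: contraNneq jC => ->.
rewrite koszul_genM !inE iC orbT.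
have -> : (j |: C) :\ i = j |: (C :\ i).
  by apply/setP => x; rewrite !inE; case: (eqVneq x j) => [->|] //=; rewrite ?ji ?andbT.
have jCi : j \notin C :\ i by rewrite !inE negb_and jC orbT.
rewrite -{1}(setD1K iC) !inversions1U //; last by rewrite !inE eqxx.
rewrite [t j * _]mulrCA !mulrA -mulNr -mulNr; congr (_ * _ * _).
have ij : ((i < j) + (j < i) = 1)%N.
  by move: ji; rewrite -val_eqE /=; case: ltngtP.
by rewrite -!exprD addnACA ij exprS mulN1r [X in _ ^+ X]addnC.
Qed.

Lemma koszul_ind (P : K -> Prop) :
  P 1 -> (forall f g, P f -> P g -> P (f + g)) ->
  (forall r f, P f -> P (koszul_rscale r f)) ->
  (forall i f, P f -> P (e i * f)) -> forall f, P f.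
Proof.
move=> P1 PD Pr Pe f.
have P0 : P 0.
  by rewrite (_ : 0 = koszul_rscale 0 1); [exact: Pr | apply/ffunP => A; rewrite !ffunE mul0r].
pose b A : K := [ffun B => (B == A)%:R].
have Pb A : P (b A).
  have [m] := ubnP #|A|; elim: m A => // m IHm A.
  have [->|[i iA]] := set_0Vmem A; first by move=> _; exact: P1.
  rewrite (cardsD1 i) iA => /IHm /Pe -/(_ i) /Pr -/(_ ((-1) ^+ inversions [set i] (A :\ i))).
  congr P; apply/ffunP => C; rewrite ffunE koszul_genM !ffunE.
  case: ifP => iC; last by rewrite mulr0; case: eqP => // CA; rewrite CA iA in iC.
  have -> : (C :\ i == A :\ i) = (C == A).
    by apply/eqP/eqP => [CA|-> //]; rewrite -(setD1K iC) CA setD1K.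
  case: eqP => [->|_]; last by rewrite !mulr0.
  by rewrite mulr1 -exprMn mulrNN mulr1 expr1n.
suff -> : f = \sum_A koszul_rscale (f A) (b A).
  by apply: (big_ind P) => // A _; exact: Pr.
apply/ffunP => C; rewrite sum_ffunE (bigD1 C) //= !ffunE eqxx mulr1 big1 ?addr0 //.
by move=> A nAC; rewrite !ffunE eq_sym (negPf nAC) mulr0.
Qed.

Lemma koszul_d1 : koszul_d 1 = 0.
Proof.
apply/ffunP => A; rewrite !ffunE big1 // => i _; rewrite ffunE.
case: eqP => [A0|_]; last by rewrite !mulr0.
by have := in_set0 i; rewrite -A0 !inE eqxx.
Qed.

Lemma koszul_sgn_genM i f : koszul_sgn (e i * f) = - (e i * koszul_sgn f).
Proof.
apply/ffunP => C; rewrite [RHS]ffunE [LHS]ffunE !koszul_genM.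
case: ifP => iC; last by rewrite mulr0 oppr0.
rewrite ffunE [in LHS](cardsD1 i) iC /= exprS !mulN1r mulNr; congr (- _).
exact: mulrCA.
Qed.

Lemma koszul_d_sgn f : koszul_d (koszul_sgn f) = - koszul_sgn (koszul_d f).
Proof.
apply/ffunP => A; rewrite [RHS]ffunE !ffunE mulr_sumr -sumrN.
apply: eq_bigr => i iA; rewrite ffunE cardsU1 iA /= exprS !mulN1r.
by rewrite mulNr !mulrN; congr (- _); rewrite [RHS]mulrCA; congr (_ * _); apply: mulrCA.
Qed.

Lemma koszul_dM f g :
  koszul_d (f * g) = koszul_d f * g + koszul_sgn f * koszul_d g.
Proof.
elim/koszul_ind: f g => [|f1 f2 IH1 IH2|r f IH|i f IH] g.
- rewrite koszul_d1 mul0r add0r !mul1r.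
  suff -> : koszul_sgn 1 = 1 by rewrite mul1r.
  apply/ffunP => A; rewrite !ffunE.
  by case: eqP => [->|_]; rewrite ?cards0 ?mulr0 ?mulr1.
- by rewrite mulrDl !linearD /= IH1 IH2 koszul_sgnD !mulrDl addrACA.
- by rewrite koszul_rscaleMl !koszul_d_rscale IH koszul_sgn_rscale
    !koszul_rscaleMl koszul_rscaleD.
- rewrite -mulrA !koszul_d_genM IH koszul_sgn_genM mulrDr mulrBl mulNr.
  by rewrite koszul_rscaleMl !mulrA opprD addrA.
Qed.

Lemma koszul_dd f : koszul_d (koszul_d f) = 0.
Proof.
elim/koszul_ind: f => [|f1 f2 IH1 IH2|r f IH|i f IH].
- by rewrite koszul_d1 linear0.
- by rewrite !linearD /= IH1 IH2 addr0.
- by rewrite !koszul_d_rscale IH; apply/ffunP => A; rewrite !ffunE mulr0.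
- rewrite koszul_d_genM linearB /= koszul_d_rscale koszul_d_genM IH.
  by rewrite mulr0 subr0 addrN.
Qed.

Definition koszul_cycle : {pred K} := fun f => koszul_d f == 0.

Fact koszul_cycle_subalg : subalg_closed koszul_cycle.
Proof.
split=> [|a f g /eqP df /eqP dg|f g /eqP df /eqP dg]; apply/eqP.
- exact: koszul_d1.
- by rewrite linearP /= df dg scaler0 addr0.
- by rewrite koszul_dM df dg mul0r mulr0 addr0.
Qed.

HB.instance Definition _ :=
  GRing.isSubalgClosed.Build k K koszul_cycle koszul_cycle_subalg.

Record cycles := Cycle { cycle_val :> K; _ : cycle_val \in koszul_cycle }.

HB.instance Definition _ := [isSub for cycle_val].
HB.instance Definition _ := [Choice of cycles by <:].
HB.instance Definition _ := [SubChoice_isSubAlgebra of cycles by <:].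

Definition boundary : {pred cycles} :=
  fun z => `[< exists g : K, cycle_val z = koszul_d g >].

Fact boundary_zmod : zmod_closed boundary.
Proof.
split=> [|x y /asboolP [f xf] /asboolP [g yg]]; apply/asboolP.
  by exists 0; rewrite linear0.
by exists (f - g); rewrite linearB /= -xf -yg.
Qed.

HB.instance Definition _ := GRing.isZmodClosed.Build cycles boundary boundary_zmod.

Lemma boundaryMl (z b : cycles) : b \in boundary -> z * b \in boundary.
Proof.
move=> /asboolP [g bg]; apply/asboolP; exists (koszul_sgn (cycle_val z) * g).
rewrite koszul_dM koszul_d_sgn koszul_sgnK -bg.
have /eqP -> : cycle_val z \in koszul_cycle := valP z.
suff -> : koszul_sgn 0 = 0 by rewrite oppr0 mul0r add0r.
by apply/ffunP => A; rewrite !ffunE mulr0.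
Qed.

Lemma boundaryMr (z b : cycles) : b \in boundary -> b * z \in boundary.
Proof.
move=> /asboolP [g bg]; apply/asboolP; exists (g * cycle_val z).
rewrite koszul_dM -bg.
have /eqP -> : cycle_val z \in koszul_cycle := valP z.
by rewrite mulr0 addr0.
Qed.

Lemma boundaryZ (a : k) (b : cycles) : b \in boundary -> a *: b \in boundary.
Proof. by move=> bB; rewrite -mulr_algl boundaryMl. Qed.

Definition koszul_homology : Type := Quotient.quot boundary.
Local Notation H := koszul_homology.

HB.instance Definition _ := GRing.Zmodule.on H.
HB.instance Definition _ := EqQuotient.on H.

Definition homology_one : H := \pi_H 1.
Definition homology_mul (x y : H) : H := \pi_H (repr x * repr y).
Definition homology_scale (a : k) (x : H) : H := \pi_H (a *: repr x).

Lemma homologyW (P : H -> Prop) :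
  (forall z : cycles, P (\pi_H z)) -> forall x, P x.
Proof. by move=> Ppi x; rewrite -[x]reprK. Qed.

Lemma pi_homologyP (x y : cycles) :
  reflect (\pi_H x = \pi_H y) (x - y \in boundary).
Proof. by rewrite Quotient.idealrBE; apply: eqP. Qed.

Lemma pi_homologyD (x y : cycles) : \pi_H (x + y) = \pi_H x + \pi_H y.
Proof. exact: (@Quotient.pi_add _ boundary). Qed.

Lemma pi_homologyM (x y : cycles) :
  \pi_H (x * y) = homology_mul (\pi_H x) (\pi_H y).
Proof.
apply/pi_homologyP; set x' := repr _; set y' := repr _.
have xx' : x - x' \in boundary by apply/pi_homologyP; rewrite reprK.
have yy' : y - y' \in boundary by apply/pi_homologyP; rewrite reprK.
rewrite (_ : _ - _ = (x - x') * y + x' * (y - y')); last first.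
  by rewrite mulrBl mulrBr addrA subrK.
by rewrite rpredD //; [exact: boundaryMr | exact: boundaryMl].
Qed.

Lemma pi_homologyZ (a : k) (x : cycles) :
  \pi_H (a *: x) = homology_scale a (\pi_H x).
Proof.
apply/pi_homologyP; rewrite -scalerBr; apply: boundaryZ.
by apply/pi_homologyP; rewrite reprK.
Qed.

Fact homology_mulA : associative homology_mul.
Proof.
move=> x y z; elim/homologyW: x => x; elim/homologyW: y => y; elim/homologyW: z => z.
by rewrite -!pi_homologyM mulrA.
Qed.

Fact homology_mul1l : left_id homology_one homology_mul.
Proof. by move=> x; elim/homologyW: x => x; rewrite -pi_homologyM mul1r. Qed.

Fact homology_mul1r : right_id homology_one homology_mul.
Proof. by move=> x; elim/homologyW: x => x; rewrite -pi_homologyM mulr1. Qed.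

Fact homology_mulDl : left_distributive homology_mul +%R.
Proof.
move=> x y z; elim/homologyW: x => x; elim/homologyW: y => y; elim/homologyW: z => z.
by rewrite -pi_homologyD -!pi_homologyM -pi_homologyD mulrDl.
Qed.

Fact homology_mulDr : right_distributive homology_mul +%R.
Proof.
move=> x y z; elim/homologyW: x => x; elim/homologyW: y => y; elim/homologyW: z => z.
by rewrite -pi_homologyD -!pi_homologyM -pi_homologyD mulrDr.
Qed.

(* The homology algebra may vanish (if some t_i is a unit), hence is only a    *)
(* possibly trivial ring.                                                      *)
HB.instance Definition _ := GRing.Zmodule_isPzRing.Build H
  homology_mulA homology_mul1l homology_mul1r homology_mulDl homology_mulDr.

Fact homology_scaleA a b x :
  homology_scale a (homology_scale b x) = homology_scale (a * b) x.
Proof. by elim/homologyW: x => x; rewrite -!pi_homologyZ scalerA. Qed.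

Fact homology_scale1 : left_id 1 homology_scale.
Proof. by move=> x; elim/homologyW: x => x; rewrite -pi_homologyZ scale1r. Qed.

Fact homology_scaleDr : right_distributive homology_scale +%R.
Proof.
move=> a x y; elim/homologyW: x => x; elim/homologyW: y => y.
by rewrite -pi_homologyD -!pi_homologyZ -pi_homologyD scalerDr.
Qed.

Fact homology_scaleDl x : {morph homology_scale^~ x : a b / a + b}.
Proof.
by move=> a b; elim/homologyW: x => x; rewrite -!pi_homologyZ -pi_homologyD scalerDl.
Qed.

HB.instance Definition _ := GRing.Zmodule_isLmodule.Build k H
  homology_scaleA homology_scale1 homology_scaleDr homology_scaleDl.

Lemma homology_scalerAl (a : k) (x y : H) : a *: (x * y) = a *: x * y.
Proof.
elim/homologyW: x => x; elim/homologyW: y => y.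
rewrite -[LHS]/(homology_scale a (homology_mul _ _)).
by rewrite -pi_homologyM -pi_homologyZ scalerAl pi_homologyM pi_homologyZ.
Qed.

Lemma homology_scalerAr (a : k) (x y : H) : a *: (x * y) = x * (a *: y).
Proof.
elim/homologyW: x => x; elim/homologyW: y => y.
rewrite -[LHS]/(homology_scale a (homology_mul _ _)).
by rewrite -pi_homologyM -pi_homologyZ scalerAr pi_homologyM pi_homologyZ.
Qed.

End KoszulComplex.

Arguments koszul_homology {k R n} t.

Section SubspaceProducts.
Variables (k : fieldType) (R : comAlgType k) (n : nat) (t : 'I_n -> R).
Local Notation H := (koszul_homology t).
Implicit Types V W : H -> Prop.

Definition subspace_mul V W : H -> Prop := fun x =>
  exists m (c : 'I_m -> k) (v w : 'I_m -> H),
    [/\ forall s, V (v s), forall s, W (w s)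
      & x = \sum_s c s *: (v s * w s)].

Definition subspace_scalars : H -> Prop := fun x => exists c : k, x = c *: (1 : H).

Definition subspace_exp V m : H -> Prop :=
  iter m (subspace_mul V) subspace_scalars.

End SubspaceProducts.

Section StandardGraded.
Variables (k : fieldType) (n : nat).
Local Notation S := {mpoly k[n]}.

Definition homogeneous_ideal (I : idealr S) : Prop :=
  forall p, p \in I -> forall d, pihomog mdeg d p \in I.

Definition in_max_ideal_square (p : S) : Prop :=
  exists q : 'I_n -> 'I_n -> S, p = \sum_i \sum_j q i j * ('X_i * 'X_j).

Variable I : idealr S.
Local Notation R := {ideal_quot I}.

Definition quot_homog (d : nat) (r : R) : Prop :=
  exists2 p : S, p \is d.-homog & r = \pi_R p.

(* r lies in R_(b - a), which is 0 when b < a. *)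
Definition quot_homog_sub (b a : nat) (r : R) : Prop :=
  r != 0 -> (a <= b)%N /\ quot_homog (b - a) r.

Definition quot_var (i : 'I_n) : R := \pi_R 'X_i.

(* Each e_A has internal degree #|A|, so that d preserves internal degrees. *)
Definition koszul_bihomog (i j : nat) (f : koszul quot_var) : Prop :=
  forall A : {set 'I_n}, f A != 0 -> #|A| = i /\ quot_homog_sub j i (f A).

Definition koszul_homology_bidegree (i j : nat) :
    koszul_homology quot_var -> Prop :=
  fun x => exists2 z : cycles quot_var,
    koszul_bihomog i j (cycle_val z) & x = \pi_(koszul_homology quot_var) z.

(* The canonical map R -> R / (T_1, ..., T_n) R = k; see [residueE]. *)
Definition residue (r : R) : k := (repr r)@_0%MM.

(* A graded free resolution of k over R by free modules of finite rank (which  *)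
(* exists, R being Noetherian). Its i-th module has a basis indexed by         *)
(* 'I_(res_rank i), the element a being of degree res_deg a; elements are row  *)
(* vectors, and maps act by right multiplication.                              *)
Record graded_free_resolution := GradedFreeResolution {
  res_rank : nat -> nat;
  res_deg : forall i, 'I_(res_rank i) -> nat;
  res_diff : forall i, 'M[R]_(res_rank i.+1, res_rank i);
  res_aug : 'cV[k]_(res_rank 0);
  _ : forall i a b,
    quot_homog_sub (@res_deg i.+1 a) (@res_deg i b) (res_diff i a b);
  _ : forall a, res_aug a 0 != 0 -> @res_deg 0 a = 0%N;
  _ : forall i (v : 'rV[R]_(res_rank i.+1)),
    v *m res_diff i = 0 <-> exists w, v = w *m res_diff i.+1;
  _ : forall v : 'rV[R]_(res_rank 0),
    map_mx residue v *m res_aug = 0 <-> exists w, v = w *m res_diff 0;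
  _ : forall c : k, exists v : 'rV[R]_(res_rank 0),
    map_mx residue v *m res_aug = c%:M
}.

Section Tor.
Variable F : graded_free_resolution.

(* The complex F (x)_R k, whose i-th term is 'rV[k]_(res_rank F i). *)
Definition tor_diff i : 'M[k]_(res_rank F i.+1, res_rank F i) :=
  map_mx residue (res_diff F i).

Definition tor_homog i (j : nat) (v : 'rV[k]_(res_rank F i)) : Prop :=
  forall a, v 0 a != 0 -> res_deg a = j.

Definition tor_cycle i : 'rV[k]_(res_rank F i) -> Prop :=
  match i with
  | 0 => fun _ => True
  | i'.+1 => fun v => v *m tor_diff i' = 0
  end.

Definition tor_boundary i (v : 'rV[k]_(res_rank F i)) : Prop :=
  exists w, v = w *m tor_diff i.

Definition tor_vanishes (i j : nat) : Prop :=
  forall v : 'rV[k]_(res_rank F i),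
    tor_homog j v -> tor_cycle v -> tor_boundary v.

End Tor.

(* Tor^R(k, k) does not depend on the resolution used to compute it. *)
Definition koszul_algebra : Prop :=
  exists F : graded_free_resolution,
    forall i j : nat, i <> j -> tor_vanishes F i j.

Lemma residueE : (forall p, p \in I -> in_max_ideal_square p) ->
  forall p : S, residue (\pi_R p) = p@_0%MM.
Proof.
move=> Im2 p; apply/eqP; rewrite /residue -subr_eq0 -mcoeffB.
have : repr (\pi_R p) - p \in I by rewrite Quotient.idealrBE reprK.
move=> /Im2 [q ->]; rewrite raddf_sum big1 //= => i _.
rewrite raddf_sum big1 //= => j _.
by rewrite !(rmorphM (mcoeff 0)) /= mcoeffX mnm1_eq0 mul0r mulr0.
Qed.

End StandardGraded.

(* Main.v *)
Require Import Defs.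
From HB Require Import structures.
From mathcomp Require Import all_boot all_order all_algebra.
From mathcomp.classical Require Import boolp.
From mathcomp Require Import mpoly.

Set Implicit Arguments.
Unset Strict Implicit.
Unset Printing Implicit Defensive.

Import GRing.Theory.

Local Open Scope ring_scope.
Local Open Scope quotient_scope.

(** The idea. Write K_i^w for the part of the Koszul complex of exterior degree i
    with coefficients in R_w; its internal degree is i + w, so the theorem is
    about cycles in K_i^(i-1), and the companion statement on the line j = 2 i
    about cycles in K_i^i. For a Koszul algebra k has a linear resolution
    R <- R^b0 <- R^b1 <- R^b2 <- ..., given by matrices D0, D1, D2, ... of linear
    forms, and its tensor product with the free modules K_i is exact in positive
    coefficient degree.

    Let z be a cycle in K_i^w, w > 0. Exactness gives a zigzag z = y1 D0,
    d y1 = y2 D1, d y2 = y3 D2, ..., where y_(p+1) has exterior degree one less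
    than y_p and all y_p have coefficients of the same degree w - 1. Whenever all
    homology of this coefficient degree and of lower exterior degree than y_p
    vanishes, y_p can be replaced by cycles (lift_to_cycles). If w > i this
    happens already for y1, and z is a combination of linear forms with cycles,
    hence a boundary, since the variables act as zero on homology
    (koszul_acyclic_lt). On the line w = i it happens for y2, and on the line
    w = i - 1 for y3.

    It remains to climb back. A linear form l = sum c_s T_s has a lift
    sum c_s e_s to K_1, and multiplication by the lift is a null homotopy of
    multiplication by l. So z = y1 D0 is homologous to a sum u_b y2_b, where
    the cycles u_b of bidegree (1, 2) come from the rows of D1
    (through_relations). On the line w = i this shows H_(i,2i) =
    H_(1,2) H_(i-1,2i-2). On the line w = i - 1 the y2_b are not cycles, but
    d y2 = y3 D2 with cycles y3, and the same homotopy corrects y2 into cycles at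
    the cost of terms v_c y3_c, where the cycles v_c of bidegree (2, 3) come from
    the rows of D2 (through_syzygies). Hence
    H_(i,2i-1) = H_(1,2) H_(i-1,2i-3) + H_(2,3) H_(i-2,2i-4) for i > 2, and the
    theorem follows by induction on i, elements of even homological degree being
    central.

    Koszulness is given by an arbitrary graded free resolution F of k, not
    necessarily minimal, with Tor_i(k, k)_j = 0 for i <> j. The linear resolution
    is built step by step from k-bases of linear syzygies, together with maps
    exhibiting it as a direct summand of F; the vanishing of Tor shows that the
    linear syzygies generate all of them (linear_resolution_of_retract). *)

(** * Homogeneous elements of the quotient ring *)

Section GradedQuotient.
Variables (k : fieldType) (n : nat) (I : idealr {mpoly k[n]}).
Local Notation S := {mpoly k[n]}.
Local Notation R := {ideal_quot I}.
Implicit Types (x y : R) (p q : S).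

Lemma quot_liftW (P : R -> Prop) : (forall p, P (\pi_R p)) -> forall x, P x.
Proof. by move=> Ppi x; rewrite -[x]reprK. Qed.

Lemma quot_scaleE (c : k) p : c *: (\pi_R p) = \pi_R (c *: p).
Proof. by rewrite -mul_mpolyC rmorphM. Qed.

Lemma quot_homog0 d : quot_homog d (0 : R).
Proof. by exists 0; [exact: dhomog0 | rewrite rmorph0]. Qed.

Lemma quot_homogD d x y : quot_homog d x -> quot_homog d y -> quot_homog d (x + y).
Proof.
move=> [p hp ->] [q hq ->]; exists (p + q); last by rewrite rmorphD.
exact: dhomogD.
Qed.

Lemma quot_homogN d x : quot_homog d x -> quot_homog d (- x).
Proof.
move=> [p hp ->]; exists (- p); last by rewrite rmorphN.
by rewrite dhomogN.
Qed.

Lemma quot_homogM d e x y :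
  quot_homog d x -> quot_homog e y -> quot_homog (d + e) (x * y).
Proof.
move=> [p hp ->] [q hq ->]; exists (p * q); last by rewrite rmorphM.
exact: dhomogM.
Qed.

Lemma quot_homog_alg (c : k) : quot_homog 0 (c%:A : R).
Proof.
exists (c *: 1); first by apply: dhomogZ; apply: dhomog1.
by rewrite -quot_scaleE rmorph1.
Qed.

Lemma quot_homogZ d (c : k) x : quot_homog d x -> quot_homog d (c *: x).
Proof. by move=> hx; rewrite -mulr_algl -[d]add0n; apply/quot_homogM/hx/quot_homog_alg. Qed.

Lemma quot_homog_sum d (J : Type) (r : seq J) (P : pred J) (F : J -> R) :
  (forall j, P j -> quot_homog d (F j)) -> quot_homog d (\sum_(j <- r | P j) F j).
Proof. by move=> hF; apply: big_ind => //; [exact: quot_homog0|exact: quot_homogD]. Qed.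

Lemma quot_homog_var i : quot_homog 1 (quot_var I i).
Proof. by exists 'X_i; rewrite // dhomogX /= mdeg1. Qed.

Lemma quot_homog_const x : quot_homog 0 x -> exists c : k, x = c%:A.
Proof.
move=> [p hp ->]; exists p@_0; rewrite -(rmorph1 \pi_R) quot_scaleE; congr (\pi_R _).
apply/mpolyP => m; rewrite mcoeffZ mcoeff1.
case: (eqVneq m 0%MM) => [->|nm0]; first by rewrite mulr1.
by rewrite mulr0 (dhomog_nemf_coeff hp) // mdeg_eq0.
Qed.

(** Each monomial of positive degree is divisible by a variable; peeling one off
    from every monomial writes a form as an element of the maximal ideal with
    coefficients that are again forms. *)
Lemma quot_homog_var_decomp d x : quot_homog d.+1 x ->
  exists2 q : 'I_n -> R, (forall s, quot_homog d (q s))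
    & x = \sum_s quot_var I s * q s.
Proof.
move=> [p hp ->]; move/dhomogP: hp => hp.
rewrite (mpolyE p) raddf_sum /=.
elim: (msupp p) hp => [|m ms IH] hp.
  exists (fun=> 0) => [s|]; first exact: quot_homog0.
  by rewrite big_nil big1 // => s _; rewrite mulr0.
have [q hq eq] : exists2 q : 'I_n -> R, (forall s, quot_homog d (q s)) &
   \sum_(j <- ms) \pi_R (p@_j *: 'X_[j]) = \sum_s quot_var I s * q s.
  by apply: IH => m' m'ms; apply: hp; rewrite inE m'ms orbT.
have mm : mdeg m = d.+1 by apply: hp; rewrite inE eqxx.
have [s ms0] : exists s, (0 < m s)%N.
  have : m != 0%MM by rewrite -mdeg_eq0 mm.
  move=> m0; apply/existsP; apply: contraNT m0 => /existsPn m0.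
  by apply/eqP/mnmP => s; rewrite mnm0E; apply/eqP; rewrite -leqn0 leqNgt m0.
have mE : m = (U_(s) + (m - U_(s)))%MM by rewrite addmC submK // lep1mP -lt0n.
exists (fun s' => q s' + (if s' == s then \pi_R (p@_m *: 'X_[m - U_(s)]) else 0)).
  move=> s'; apply: quot_homogD => //; case: eqP => _; last exact: quot_homog0.
  exists (p@_m *: 'X_[m - U_(s)]) => //; apply: dhomogZ; rewrite dhomogX /=.
  by move: mm; rewrite {1}mE mdegD mdeg1 add1n => -[->].
rewrite big_cons eq addrC; under [RHS]eq_bigr do rewrite mulrDr.
rewrite big_split /=; congr (_ + _).
rewrite (bigD1 s) //= eqxx big1 ?addr0; last first.
  by move=> s' /negPf->; rewrite mulr0.
by rewrite -rmorphM /= -scalerAr -mpolyXD -mE.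
Qed.

(** The degree-d component is computed on representatives; this is legitimate
    only because I is homogeneous. *)
Definition quot_comp d x : R := \pi_R (pihomog mdeg d (repr x)).

Lemma quot_comp_homog d x : quot_homog d (quot_comp d x).
Proof. by exists (pihomog mdeg d (repr x)) => //; apply: pihomogP. Qed.

Hypothesis I_homogeneous : homogeneous_ideal I.

Lemma quot_compE d p : quot_comp d (\pi_R p) = \pi_R (pihomog mdeg d p).
Proof.
apply/eqP; rewrite -Quotient.idealrBE -linearB /=; apply: I_homogeneous.
by rewrite Quotient.idealrBE reprK.
Qed.

Lemma quot_compD d : {morph quot_comp d : x y / x + y}.
Proof.
move=> x y; elim/quot_liftW: x => p; elim/quot_liftW: y => q.
by rewrite -rmorphD !quot_compE linearD rmorphD.
Qed.

Lemma quot_comp0 d : quot_comp d 0 = 0.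
Proof. by rewrite -(rmorph0 \pi_R) quot_compE linear0. Qed.

Lemma quot_comp_id d x : quot_homog d x -> quot_comp d x = x.
Proof. by move=> [p hp ->]; rewrite quot_compE pihomog_dE. Qed.

Lemma quot_comp_neq d e x : quot_homog d x -> d != e -> quot_comp e x = 0.
Proof. by move=> [p hp ->] ne; rewrite quot_compE (pihomog_ne0 ne) ?rmorph0. Qed.

(** R is spanned by its homogeneous elements, so that additive properties need
    only be checked on these. *)
Lemma quot_ind (P : R -> Prop) : P 0 -> (forall x y, P x -> P y -> P (x + y)) ->
  (forall d x, quot_homog d x -> P x) -> forall x, P x.
Proof.
move=> P0 PD Ph; elim/quot_liftW => p.
rewrite (pihomog_partitionE (leqnn (mmeasure mdeg p))) raddf_sum /=.
by apply: big_ind => // i _; apply: (Ph i); exists (pihomog mdeg i p) => //; apply: pihomogP.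
Qed.

Lemma quot_compMr d e x y : quot_homog e y ->
  quot_comp d (x * y) = if (e <= d)%N then quot_comp (d - e) x * y else 0.
Proof.
move=> hy; elim/quot_ind: x => [|x1 x2 IH1 IH2|c x hx].
- by rewrite mul0r !quot_comp0 mul0r if_same.
- by rewrite mulrDl !quot_compD IH1 IH2; case: ifP; rewrite ?mulrDl // addr0.
have hxy := quot_homogM hx hy.
case: leqP => [led|ltd]; last first.
  by apply: (quot_comp_neq hxy); rewrite neq_ltn (leq_trans ltd) ?leq_addl ?orbT.
case: (eqVneq c (d - e)%N) => [ce|ne].
  by rewrite ce in hx hxy *; rewrite (quot_comp_id hx) quot_comp_id // -{1}(subnK led).
rewrite (quot_comp_neq hx ne) mul0r; apply: (quot_comp_neq hxy).
by apply: contraNneq ne => <-; rewrite addnK.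
Qed.

Lemma quot_homog_subP d w x : quot_homog_sub (d + w) d x <-> quot_homog w x.
Proof.
rewrite /quot_homog_sub leq_addr addKn; split => [|hx _ //].
by have [->|_ /(_ isT)[]//] := eqVneq x 0; move=> _; apply: quot_homog0.
Qed.

Lemma quot_homog_sub0 b a : quot_homog_sub b a (0 : R).
Proof. by rewrite /quot_homog_sub eqxx. Qed.

Lemma quot_homog_sub_le b a x : (a <= b)%N ->
  quot_homog_sub b a x <-> quot_homog (b - a) x.
Proof. by move=> ab; rewrite -{1}(subnKC ab) quot_homog_subP. Qed.

Lemma quot_homog_sub_lt b a x : (b < a)%N -> quot_homog_sub b a x -> x = 0.
Proof.
by move=> ba; have [//|nx] := eqVneq x 0 => /(_ nx)[]; rewrite leqNgt ba.
Qed.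

Lemma quot_homog_subD b a x y :
  quot_homog_sub b a x -> quot_homog_sub b a y -> quot_homog_sub b a (x + y).
Proof.
case: (leqP a b) => ab; first by rewrite !quot_homog_sub_le //; apply: quot_homogD.
by move=> /(quot_homog_sub_lt ab)-> /(quot_homog_sub_lt ab)->; rewrite addr0; apply: quot_homog_sub0.
Qed.

Lemma quot_homog_subM c b a x y :
  quot_homog_sub c b x -> quot_homog_sub b a y -> quot_homog_sub c a (x * y).
Proof.
case: (leqP b c) => bc; last first.
  by move=> /(quot_homog_sub_lt bc)-> _; rewrite mul0r; apply: quot_homog_sub0.
case: (leqP a b) => ab; last first.
  by move=> _ /(quot_homog_sub_lt ab)->; rewrite mulr0; apply: quot_homog_sub0.
rewrite (quot_homog_sub_le _ (leq_trans ab bc)) !quot_homog_sub_le //.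
move=> hx hy; have := quot_homogM hx hy; congr quot_homog.
by rewrite addnBA // subnK.
Qed.

(** Degrees are tracked as differences b - a, a being the degree of a generator
    of a free module: matrices between graded free modules then multiply without
    any side condition on truncated subtractions. *)
Definition quot_comp_sub b a x : R := if (a <= b)%N then quot_comp (b - a) x else 0.

Lemma quot_comp_sub_homog b a x : quot_homog_sub b a (quot_comp_sub b a x).
Proof.
rewrite /quot_comp_sub; case: ifP => ab; last exact: quot_homog_sub0.
by rewrite quot_homog_sub_le //; apply: quot_comp_homog.
Qed.

Lemma quot_comp_sub_id b a x : quot_homog_sub b a x -> quot_comp_sub b a x = x.
Proof.
rewrite /quot_comp_sub; case: (leqP a b) => ab; last by move=> /(quot_homog_sub_lt ab)->.
by rewrite quot_homog_sub_le //; apply: quot_comp_id.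
Qed.

Lemma quot_comp_subD b a : {morph quot_comp_sub b a : x y / x + y}.
Proof. by move=> x y; rewrite /quot_comp_sub; case: ifP; rewrite ?addr0 // quot_compD. Qed.

Lemma quot_comp_sub0 b a : quot_comp_sub b a 0 = 0.
Proof. by rewrite /quot_comp_sub quot_comp0 if_same. Qed.

Lemma quot_comp_sub_sum b a (J : Type) (r : seq J) (F : J -> R) :
  quot_comp_sub b a (\sum_(j <- r) F j) = \sum_(j <- r) quot_comp_sub b a (F j).
Proof. exact: (big_morph _ (@quot_comp_subD b a) (@quot_comp_sub0 b a)). Qed.

Lemma quot_comp_subMr c b a x y : quot_homog_sub b a y ->
  quot_comp_sub c a (x * y) = quot_comp_sub c b x * y.
Proof.
case: (leqP a b) => ab; last by move=> /(quot_homog_sub_lt ab)->; rewrite ?mulr0 ?quot_comp_sub0.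
rewrite quot_homog_sub_le // => hy; rewrite /quot_comp_sub (quot_compMr _ _ hy).
case: (leqP b c) => bc; last first.
  by rewrite mul0r; case: leqP => // ac; rewrite leq_sub2rE // leqNgt bc.
rewrite (leq_trans ab bc) leq_sub2r //.
by rewrite subnBA // subnK // (leq_trans ab bc).
Qed.

Hypothesis I_sub_square : forall p, p \in I -> in_max_ideal_square p.

Fact residue_is_additive : zmod_morphism (@residue k n I).
Proof.
move=> x y; elim/quot_liftW: x => p; elim/quot_liftW: y => q.
by rewrite -rmorphB !residueE // mcoeffB.
Qed.

Fact residue_is_multiplicative : monoid_morphism (@residue k n I).
Proof.
split=> [|x y]; first by rewrite -(rmorph1 \pi_R) residueE // mcoeff1 eqxx.
elim/quot_liftW: x => p; elim/quot_liftW: y => q.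
by rewrite -rmorphM !residueE // rmorphM.
Qed.

Lemma residue_homog d x : quot_homog d.+1 x -> residue x = 0.
Proof.
by move=> [p hp ->]; rewrite residueE // (dhomog_nemf_coeff hp) // mf0.
Qed.

Lemma residue_alg (c : k) : residue (c%:A : R) = c.
Proof. by rewrite -(rmorph1 \pi_R) quot_scaleE residueE // mcoeffZ mcoeff1 eqxx mulr1. Qed.

Lemma residue_homog0 x : quot_homog 0 x -> x = (residue x)%:A.
Proof. by move=> /quot_homog_const[c ->]; rewrite residue_alg. Qed.

Lemma residue_comp d x : residue x = 0 -> residue (quot_comp d x) = 0.
Proof.
case: d => [|d] rx; last exact/residue_homog/quot_comp_homog.
elim/quot_liftW: x rx => p; rewrite quot_compE !residueE // => p0.
suff -> : (pihomog mdeg 0 p)@_0 = p@_0 by [].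
rewrite [p in RHS](pihomog_partitionE (leqnSn (mmeasure mdeg p))).
rewrite [RHS]raddf_sum big_ord_recl /= big1 ?addr0 // => j _.
by apply: (dhomog_nemf_coeff (pihomogP _ _ _)); rewrite mf0.
Qed.

End GradedQuotient.

(** * The linear resolution of the residue field *)

Section LinearResolution.
Variables (k : fieldType) (n : nat) (I : idealr {mpoly k[n]}).
Local Notation R := {ideal_quot I}.
Local Notation T := (quot_var I).
Local Notation "A ^K" := (map_mx (in_alg R) A) (at level 2, format "A ^K").

Definition homog_row w a (v : 'rV[R]_a) : Prop := forall j, quot_homog w (v 0 j).

Definition submodule_pred a (Z : 'rV[R]_a -> Prop) : Prop :=
  Z 0 /\ forall x u v, Z u -> Z v -> Z (x *: u + v).

(** A submodule Z of R^a has a linear resolution of length m when it is generated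
    by linear vectors and the relations between these have a linear resolution
    of length m - 1. Exactness is graded: homogeneous vectors of positive degree
    lift to homogeneous vectors of degree one less. *)
Fixpoint linear_resolution m a (Z : 'rV[R]_a -> Prop) : Prop :=
  if m is m'.+1 then
    exists b (D : 'M[R]_(b, a)),
      [/\ forall i j, quot_homog 1 (D i j),
          forall i, Z (row i D),
          forall w v, homog_row w.+1 v -> Z v ->
            exists2 u, homog_row w u & v = u *m D
        & linear_resolution m' (fun u : 'rV[R]_b => u *m D = 0)]
  else True.

Lemma submodule_ker a b (D : 'M[R]_(b, a)) :
  submodule_pred (fun u : 'rV[R]_b => u *m D = 0).
Proof.
split=> [|x u v Du Dv]; first exact: mul0mx.
by rewrite mulmxDl -scalemxAl Du Dv scaler0 addr0.
Qed.

(** The vectors x^K *m L, with x over k, form a finite-dimensional k-space. An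
    independent family inside Z has at most N members, so a longest one exists,
    and it spans everything in Z: a vector outside its span would extend it. *)
Lemma max_independent_family N a (L : 'M[R]_(N, a)) (Z : 'rV[R]_a -> Prop) :
  submodule_pred Z -> exists b (A : 'M[k]_(b, N)),
  [/\ forall i, Z (row i (A^K *m L)),
      forall c : 'rV[k]_b, c^K *m (A^K *m L) = 0 -> c = 0
    & forall x : 'rV[k]_N, Z (x^K *m L) ->
        exists c : 'rV[k]_b, x^K *m L = c^K *m (A^K *m L)].
Proof.
move=> ZS.
pose P b (A : 'M[k]_(b, N)) := (forall i, Z (row i (A^K *m L))) /\
  forall c : 'rV[k]_b, c^K *m (A^K *m L) = 0 -> c = 0.
pose p b := `[< exists A, @P b A >].
have p0 : exists b, p b.
  exists 0%N; apply/asboolP; exists 0; split=> [[]//|c _].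
  by apply/rowP => -[].
have pN b : p b -> (b <= N)%N.
  move=> /asboolP [A [_ Ainj]]; suff /eqP <- : row_free A by apply: rank_leq_col.
  apply: inj_row_free => v vA; apply: Ainj.
  by rewrite mulmxA -map_mxM vA map_mx0 mul0mx.
case: (ex_maxnP p0 pN) => b /asboolP [A [ZA Ainj]] bmax.
exists b, A; split=> // x Zx; apply: contrapT => nx.
suff /bmax : p (b + 1)%N by rewrite addn1 ltnn.
apply/asboolP; exists (col_mx A x); split=> [i|c].
  rewrite map_col_mx mul_col_mx; case: (splitP i) => j ij.
    have -> : i = lshift 1 j by apply: val_inj.
    by rewrite rowKu.
  have -> : i = rshift b j by apply: val_inj.
  by rewrite rowKd row_id.
rewrite -[c]hsubmxK; set c1 := lsubmx c; set c2 := rsubmx c.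
rewrite map_row_mx map_col_mx mul_col_mx mul_row_col => eq0.
have c20 : c2 = 0.
  apply: contrapT => c2n; apply: nx; exists (- (c2 0 0)^-1 *: c1).
  have c2n0 : c2 0 0 != 0.
    by apply/eqP => c200; apply: c2n; apply/rowP => j; rewrite ord1 c200 mxE.
  have c2E : c2^K *m (x^K *m L) = in_alg R (c2 0 0) *: (x^K *m L).
    by apply/rowP => j; rewrite [LHS]mxE big_ord1 !mxE.
  move/eqP: eq0; rewrite c2E addr_eq0 => /eqP c1E.
  rewrite map_mxZ -scalemxAl c1E scalerN -scaleNr scalerA -rmorphN opprK.
  by rewrite -rmorphM mulVf // rmorph1 scale1r.
rewrite c20; move: eq0; rewrite c20 map_mx0 mul0mx addr0 => /Ainj ->.
by rewrite row_mx0.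
Qed.

(** The generators of one step of the linear resolution. Independence over k of
    the rows of D is what makes the next step start without vectors of
    degree 0. *)
Lemma linear_basis a (Z : 'rV[R]_a -> Prop) :
  submodule_pred Z -> exists b (D : 'M[R]_(b, a)),
  [/\ forall i j, quot_homog 1 (D i j),
      forall i, Z (row i D),
      forall c : 'rV[k]_b, c^K *m D = 0 -> c = 0
    & forall v, homog_row 1 v -> Z v ->
        exists c : 'rV[k]_b, v = c^K *m D].
Proof.
move=> ZS; pose N := #|{: 'I_n * 'I_a}|.
pose L : 'M[R]_(N, a) := \matrix_(i, j)
  if (enum_val i).2 == j then T (enum_val i).1 else 0.
have [b [A [ZA Ainj Aspan]]] := max_independent_family L ZS.
exists b, (A^K *m L); split=> // [i j|v hv Zv].
  rewrite mxE; apply: quot_homog_sum => s _; rewrite !mxE -[1%N]add0n.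
  apply: quot_homogM; first exact: quot_homog_alg.
  by case: eqP => _; [exact: quot_homog_var|exact: quot_homog0].
suff [x vx] : exists x : 'rV[k]_N, v = x^K *m L.
  by move: Zv; rewrite vx => /Aspan.
have /choice [q qP] : forall j, exists q : 'I_n -> k, v 0 j = \sum_s (q s)%:A * T s.
  move=> j; have [q hq ->] := quot_homog_var_decomp (hv j).
  have /choice [c cP] : forall s, exists c : k, q s = c%:A.
    by move=> s; apply: quot_homog_const.
  by exists c; apply: eq_bigr => s _; rewrite cP mulrC.
exists (\row_i q (enum_val i).2 (enum_val i).1).
apply/rowP => j; rewrite qP mxE.
transitivity (\sum_(i : 'I_n * 'I_a)
    (q i.2 i.1)%:A * (if i.2 == j then T i.1 else 0)).
  rewrite -(pair_bigA _ (fun s i => (q i s)%:A * (if i == j then T s else 0))) /=.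
  apply: eq_bigr => s _; rewrite (bigD1 j) //= eqxx big1 ?addr0 // => i /negPf ->.
  by rewrite mulr0.
by rewrite big_enum_val; apply: eq_bigr => i _; rewrite !mxE.
Qed.

Lemma res_diff_graded (F : graded_free_resolution I) i a b :
  quot_homog_sub (@res_deg _ _ _ F i.+1 a) (@res_deg _ _ _ F i b) (res_diff F i a b).
Proof. by case: F a b. Qed.

Lemma res_exact (F : graded_free_resolution I) i (v : 'rV_(res_rank F i.+1)) :
  v *m res_diff F i = 0 <-> exists w, v = w *m res_diff F i.+1.
Proof. by case: F v. Qed.

Lemma res_diff_diff (F : graded_free_resolution I) i :
  res_diff F i.+1 *m res_diff F i = 0.
Proof.
apply/row_matrixP => j; rewrite row_mul row0 rowE.
by apply/res_exact; exists (delta_mx 0 j).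
Qed.

Section Comparison.
Hypothesis I_homogeneous : homogeneous_ideal I.
Hypothesis I_sub_square : forall p, p \in I -> in_max_ideal_square p.
Variable F : graded_free_resolution I.
Local Notation rk := (res_rank F).
Local Notation deg := (@res_deg _ _ _ F _).
Local Notation dF := (res_diff F).
Local Notation res := (map_mx (@residue k n I)).

#[local] HB.instance Definition _ :=
  GRing.isZmodMorphism.Build R k (@residue k n I) (residue_is_additive I_sub_square).
#[local] HB.instance Definition _ :=
  GRing.isMonoidMorphism.Build R k (@residue k n I) (residue_is_multiplicative I_sub_square).

Definition graded_row e p (v : 'rV[R]_(rk p)) : Prop :=
  forall j, quot_homog_sub e (deg j) (v 0 j).

(** F is exact without regard to degrees; as its differential is homogeneous,
    taking the components of the right degree in a lift gives a lift again, and
    keeps it inside the maximal ideal if it was there. *)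
Lemma graded_lift e p (v : 'rV_(rk p)) (u : 'rV_(rk p.+1)) :
  graded_row e v -> v = u *m dF p ->
  let u' := \row_j quot_comp_sub e (deg j) (u 0 j) in
  [/\ graded_row e u', v = u' *m dF p & res u = 0 -> res u' = 0].
Proof.
move=> hv vE u'; split=> [j||ru].
- by rewrite mxE; apply: quot_comp_sub_homog.
- apply/rowP => j; rewrite -(quot_comp_sub_id I_homogeneous (hv j)) vE !mxE.
  rewrite quot_comp_sub_sum //; apply: eq_bigr => i _; rewrite mxE.
  by apply: quot_comp_subMr => //; apply: res_diff_graded.
- apply/rowP => j; rewrite !mxE /quot_comp_sub; case: ifP => _; last exact: rmorph0.
  by apply: residue_comp => //; move/rowP: ru => /(_ j); rewrite !mxE.
Qed.

Lemma graded_row_decomp e p (u : 'rV_(rk p)) : graded_row e.+1 u -> res u = 0 ->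
  exists q : 'I_n -> 'rV_(rk p),
    (forall s, graded_row e (q s)) /\ u = \sum_s T s *: q s.
Proof.
move=> hu ru.
have /choice [q qP] : forall j, exists q : 'I_n -> R,
    (forall s, quot_homog_sub e (deg j) (q s)) /\ u 0 j = \sum_s T s * q s.
  move=> j; have := hu j; case: (leqP (deg j) e) => dj.
    rewrite quot_homog_sub_le // ?(leqW dj) // subSn // => /quot_homog_var_decomp [q hq ->].
    by exists q; split=> // s; rewrite quot_homog_sub_le.
  move=> huj; have uj0 : u 0 j = 0.
    move: dj; rewrite leq_eqVlt => /orP[/eqP dj|dj]; last exact: quot_homog_sub_lt huj.
    move: huj; rewrite quot_homog_sub_le dj // subnn => /(residue_homog0 I_sub_square)->.
    by move/rowP: ru => /(_ j); rewrite !mxE => ->; rewrite scale0r.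
  exists (fun=> 0); split=> [s|]; first exact: quot_homog_sub0.
  by rewrite uj0 big1 // => s _; rewrite mulr0.
exists (fun s => \row_j q j s); split=> [s j|].
  by rewrite mxE; case: (qP j).
apply/rowP => j; rewrite summxE; case: (qP j) => _ ->.
by apply: eq_bigr => s _; rewrite !mxE.
Qed.

Definition is_image p (v : 'rV[R]_(rk p)) := exists u, v = u *m dF p.

(** The free module around Z, generated in degree p, is a graded direct summand
    of the p-th module of F, in such a way that Z corresponds to the syzygies.
    Any minimal resolution is such a summand of F; here this is what transports
    the vanishing of Tor from F to the resolution under construction. *)
Definition retract_of_syzygy p a (Z : 'rV[R]_a -> Prop) : Prop :=
  exists (phi : 'M[R]_(a, rk p)) (psi : 'M[R]_(rk p, a)),
  [/\ forall i j, quot_homog_sub p (deg j) (phi i j),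
      forall i j, quot_homog_sub (deg i) p (psi i j),
      forall v, Z v -> is_image (v *m phi),
      forall v, is_image v -> Z (v *m psi)
    & phi *m psi = 1%:M].

(** A syzygy v of degree p + w + 2 becomes in F a boundary, of u say. Modulo the
    maximal ideal u is a cycle of F (x) k, as v has entries in the maximal ideal;
    its degree p + w + 2 differs from p + 1, so it is a boundary, and subtracting
    a lift of the latter moves u into the maximal ideal. Writing u as a
    combination of the variables and going back along psi does the same for v,
    with coefficients that are again syzygies. *)
Lemma generated_in_lower_degree p a (Z : 'rV[R]_a -> Prop) w v :
  retract_of_syzygy p Z -> tor_vanishes F p.+1 (p + w.+2) ->
  homog_row w.+2 v -> Z v ->
  exists vs : 'I_n -> 'rV_a,
    (forall s, homog_row w.+1 (vs s) /\ Z (vs s)) /\ v = \sum_s T s *: vs s.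
Proof.
move=> [phi [psi [gphi gpsi Zphi Zpsi phipsi]]] tor0 hv Zv.
have gvphi : graded_row (p + w.+2) (v *m phi).
  move=> j; rewrite mxE; apply: big_ind => [|x y|i _].
  - exact: quot_homog_sub0.
  - exact: quot_homog_subD.
  - by apply/quot_homog_subM/gphi; apply/quot_homog_subP.
have [u uE] := Zphi _ Zv.
have [] := graded_lift gvphi uE; set u1 := \row_j _ => gu1 u1E _.
have [||c cE] := tor0 (res u1).
- move=> j; rewrite mxE => ru.
  have := gu1 j; case: (ltngtP (deg j) (p + w.+2)) => // [lt|lt].
    rewrite quot_homog_sub_le ?(ltnW lt) //.
    have : (0 < p + w.+2 - deg j)%N by rewrite subn_gt0.
    case: (_ - _)%N => // d _ /residue_homog; move/(_ I_sub_square) => r0.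
    by rewrite r0 eqxx in ru.
  by move/(quot_homog_sub_lt lt) => u10; rewrite u10 rmorph0 eqxx in ru.
- rewrite /= /tor_diff -map_mxM -u1E map_mxM.
  have -> : res v = 0.
    by apply/rowP => j; rewrite !mxE; apply: (residue_homog I_sub_square (hv j)).
  by rewrite mul0mx.
have u2E : v *m phi = (u1 - c^K *m dF p.+1) *m dF p.
  by rewrite mulmxBl -mulmxA res_diff_diff mulmx0 subr0.
have ru2 : res (u1 - c^K *m dF p.+1) = 0.
  rewrite map_mxB map_mxM cE; have -> : res c^K = c.
    by apply/rowP => j; rewrite !mxE /= residue_alg.
  by rewrite subrr.
have [] := graded_lift gvphi u2E; set u3 := \row_j _ => gu3 u3E /(_ ru2) ru3.
rewrite addnS in gu3.
have [q [gq qE]] := graded_row_decomp gu3 ru3.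
exists (fun s => q s *m dF p *m psi); split=> [s|].
  split; last by apply: Zpsi; exists (q s).
  move=> j; apply/(quot_homog_subP p); rewrite mxE; apply: big_ind => [|x y|i _].
  - exact: quot_homog_sub0.
  - exact: quot_homog_subD.
  apply/quot_homog_subM/gpsi; rewrite mxE; apply: big_ind => [|x y|i' _].
  - exact: quot_homog_sub0.
  - exact: quot_homog_subD.
  - by apply: quot_homog_subM (gq s i') _; apply: res_diff_graded.
rewrite -[v]mulmx1 -phipsi mulmxA u3E qE !mulmx_suml.
by apply: eq_bigr => s _; rewrite !scalemxAl.
Qed.

Lemma choose_rows m a (Q : 'I_m -> 'rV[R]_a -> Prop) :
  (forall i, exists u, Q i u) -> exists M : 'M[R]_(m, a), forall i, Q i (row i M).
Proof.
move=> /choice [f fQ]; exists (\matrix_i f i) => i.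
by rewrite rowK.
Qed.

(** One more step of the linear resolution: all syzygies come from linear ones by
    generated_in_lower_degree. Exactness on both sides then extends phi and psi
    to the next step, and phi psi = 1 survives because an endomorphism of
    degree 0 that kills linearly independent relations vanishes. *)
Lemma linear_resolution_of_retract m p a (Z : 'rV[R]_a -> Prop) :
  (forall i j, i <> j -> tor_vanishes F i j) ->
  submodule_pred Z -> (forall v, homog_row 0 v -> Z v -> v = 0) ->
  retract_of_syzygy p Z -> linear_resolution m Z.
Proof.
move=> koszulF; elim: m p a Z => //= m IH p a Z ZS Z0 ZR.
have [b [D [D1 ZD Dinj Dspan]]] := linear_basis ZS.
have Dexact w v : homog_row w.+1 v -> Z v ->
    exists2 u, homog_row w u & v = u *m D.
  elim: w v => [|w IHw] v hv Zv.
    have [c ->] := Dspan v hv Zv; exists c^K => // j.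
    by rewrite mxE; apply: quot_homog_alg.
  have [|vs [vsP ->]] := generated_in_lower_degree ZR _ hv Zv.
    by apply: koszulF; rewrite !addnS => -[/eqP]; rewrite -[X in X == _]addn0 -addnS eqn_add2l.
  have /choice [us usP] : forall s, exists u, homog_row w u /\ vs s = u *m D.
    by move=> s; case: (vsP s) => hvs /(IHw _ hvs)[u]; exists u.
  exists (\sum_s T s *: us s).
    move=> j; rewrite summxE; apply: quot_homog_sum => s _; rewrite mxE -add1n.
    by apply: quot_homogM; [exact: quot_homog_var|case: (usP s)].
  rewrite mulmx_suml; apply: eq_bigr => s _.
  by rewrite -scalemxAl; case: (usP s) => _ <-.
exists b, D; split=> //; apply: (IH p.+1).
- exact: submodule_ker.
- move=> u hu; have -> : u = (res u)^K.
    by apply/rowP => j; rewrite !mxE; apply: (residue_homog0 I_sub_square (hu j)).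
  by move=> /Dinj ->; rewrite map_mx0.
have [phi [psi [gphi gpsi Zphi Zpsi phipsi]]] := ZR.
have [phi' phi'P] : exists M, forall i,
    graded_row p.+1 (row i M) /\ row i (D *m phi) = row i M *m dF p.
  apply: (choose_rows (Q := fun i u => graded_row p.+1 u /\
    row i (D *m phi) = u *m dF p)) => i; rewrite row_mul; have [u uE] := Zphi _ (ZD i).
  have gv : graded_row p.+1 (row i D *m phi).
    move=> j; rewrite mxE; apply: big_ind => [|x y|i' _].
    - exact: quot_homog_sub0.
    - exact: quot_homog_subD.
    - by apply/quot_homog_subM/gphi; rewrite mxE -addn1; apply/quot_homog_subP.
  by have [gu' u'E _] := graded_lift gv uE; eexists; split; [exact: gu'|].
have [psi' psi'P] : exists M : 'M[R]_(rk p.+1, b), forall i,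
    (forall j, quot_homog_sub (deg i) p.+1 (row i M 0 j)) /\
    row i (dF p *m psi) = row i M *m D.
  apply: (choose_rows (Q := fun i u =>
    (forall j, quot_homog_sub (deg i) p.+1 (u 0 j)) /\
    row i (dF p *m psi) = u *m D)) => i; set v := row i _.
  have Zv : Z v by rewrite /v row_mul; apply: Zpsi; exists (delta_mx 0 i); rewrite rowE.
  have gv j : quot_homog_sub (deg i) p (v 0 j).
    rewrite /v !mxE; apply: big_ind => [|x y|i' _].
    - exact: quot_homog_sub0.
    - exact: quot_homog_subD.
    - by apply: quot_homog_subM (gpsi _ _); apply: res_diff_graded.
  case: (ltnP p (deg i)) => pd.
    have [|u hu vE] := Dexact (deg i - p.+1)%N v _ Zv.
      by move=> j; rewrite -subSn // subSS -quot_homog_sub_le // ltnW.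
    by exists u; split=> // j; rewrite quot_homog_sub_le.
  exists 0; split=> [j|]; first by rewrite mxE; apply: quot_homog_sub0.
  rewrite mul0mx; apply: Z0 => // j; have [e|ne] := eqVneq (deg i) p.
    by move: (gv j); rewrite quot_homog_sub_le e // subnn.
  have lt : (deg i < p)%N by rewrite ltn_neqAle ne.
  by rewrite (quot_homog_sub_lt lt (gv j)); apply: quot_homog0.
have Dphi : D *m phi = phi' *m dF p.
  by apply/row_matrixP => i; rewrite [RHS]row_mul; case: (phi'P i).
have Fpsi : dF p *m psi = psi' *m D.
  by apply/row_matrixP => i; rewrite [RHS]row_mul; case: (psi'P i).
have gphi' i j : quot_homog_sub p.+1 (deg j) (phi' i j).
  by case: (phi'P i) => /(_ j); rewrite mxE.
have gpsi' i j : quot_homog_sub (deg i) p.+1 (psi' i j).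
  by case: (psi'P i) => /(_ j); rewrite mxE.
exists phi', psi'; split=> //.
- by move=> v vD; apply/res_exact; rewrite -mulmxA -Dphi mulmxA vD mul0mx.
- move=> v [u ->]; rewrite -mulmxA -Fpsi mulmxA -[_ *m dF p]mulmxA.
  by rewrite res_diff_diff mulmx0 mul0mx.
(* phi' psi' - 1 has entries in k and kills D, whose rows are independent.    *)
apply/eqP; rewrite -subr_eq0; apply/eqP/row_matrixP => i; rewrite row0.
set d := row i _.
have dE : d = (res d)^K.
  apply/rowP => j; rewrite !mxE; apply: residue_homog0 => //.
  apply/(quot_homog_subP p.+1); rewrite addn0; apply: quot_homog_subD.
    apply: big_ind => [|x y|i' _].
    - exact: quot_homog_sub0.
    - exact: quot_homog_subD.
    - exact: quot_homog_subM (gphi' _ _) (gpsi' _ _).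
  rewrite quot_homog_sub_le // subnn; apply: quot_homogN.
  case: eqP => _; last exact: quot_homog0.
  by rewrite -[1%:R]scale1r; apply: quot_homog_alg.
suff : d *m D = 0 by rewrite dE => /Dinj ->; rewrite map_mx0.
rewrite -row_mul mulmxBl mul1mx -mulmxA -Fpsi mulmxA -Dphi -mulmxA phipsi.
by rewrite mulmx1 subrr row0.
Qed.

(** The resolution starts with the maximal ideal inside R. A vector of F_0 of
    augmentation 1 may be replaced by its constant part in degree 0, since the
    augmentation vanishes on generators of other degrees. *)
Lemma residue_retract :
  retract_of_syzygy 0 (fun v : 'rV[R]_1 => residue (v 0 0) = 0).
Proof.
have aug_deg a : res_aug F a 0 != 0 -> deg a = 0%N.
  by move: a; case: F.
have aug_exact v : res v *m res_aug F = 0 <-> is_image v.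
  by move: v; rewrite /is_image; case: F.
have [v0 v0E] : exists v0, res v0 *m res_aug F = 1%:M.
  by case: F => ? ? ? ? ? ? ? ? surj; apply: surj.
pose phi : 'rV[R]_(rk 0) :=
  \row_j if deg j == 0%N then (residue (v0 0 j))%:A else 0.
have phi_aug : phi *m (res_aug F)^K = 1%:M.
  apply/rowP => i; rewrite ord1.
  transitivity (in_alg R ((res v0 *m res_aug F) 0 0)); last first.
    by rewrite v0E !mxE rmorph1.
  rewrite !mxE rmorph_sum.
  apply: eq_bigr => j _; rewrite !mxE rmorphM.
  case: (eqVneq (res_aug F j 0) 0) => [->|/aug_deg ->]; last by [].
  by rewrite /= scale0r !mulr0.
have res_aug_lift (v : 'rV_(rk 0)) : residue ((v *m (res_aug F)^K) 0 0) = (res v *m res_aug F) 0 0.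
  rewrite !mxE rmorph_sum; apply: eq_bigr => j _.
  by rewrite !mxE rmorphM /= residue_alg.
exists phi, (res_aug F)^K; split=> //.
- move=> i j; rewrite mxE; case: eqP => [dj|_]; last exact: quot_homog_sub0.
  by rewrite quot_homog_sub_le dj //; apply: quot_homog_alg.
- move=> i j; rewrite mxE ord1; case: (eqVneq (res_aug F i 0) 0) => [->|/aug_deg di].
    by rewrite /= scale0r; apply: quot_homog_sub0.
  by rewrite quot_homog_sub_le di //; apply: quot_homog_alg.
- move=> v rv; apply/aug_exact; apply/rowP => i; rewrite ord1 -res_aug_lift.
  by rewrite -mulmxA phi_aug mulmx1 rv mxE.
- by move=> v /aug_exact v0'; rewrite res_aug_lift v0' mxE.
Qed.

End Comparison.

Theorem koszul_linear_resolution m : homogeneous_ideal I ->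
  (forall p, p \in I -> in_max_ideal_square p) -> koszul_algebra I ->
  linear_resolution m (fun v : 'rV[R]_1 => residue (v 0 0) = 0).
Proof.
move=> Ihom Isq [F koszulF].
apply: (linear_resolution_of_retract Ihom Isq m koszulF _ _ (residue_retract Isq F)).
  have rD := residue_is_additive Isq; have [rM0 rM] := residue_is_multiplicative Isq.
  have r0 : residue (0 : R) = 0 by rewrite -(subrr 0) rD subrr.
  have rA (x y : R) : residue (x + y) = residue x + residue y.
    by rewrite -{1}[y]opprK rD -[- y]sub0r rD r0 sub0r opprK.
  split=> [|x u v u0 v0]; first by rewrite mxE.
  by rewrite !mxE rA rM u0 v0 mulr0 addr0.
move=> v hv v0; apply/rowP => j; rewrite ord1 mxE.
by rewrite (residue_homog0 Isq (hv 0)) v0 scale0r.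
Qed.

End LinearResolution.

(** * Degrees and zigzags in the Koszul complex *)

Section KoszulRowAlgebra.
Variables (k : fieldType) (R : comAlgType k) (n : nat) (t : 'I_n -> R).
Local Notation K := (koszul t).
Local Notation rscale := koszul_rscale.

Lemma koszul_sumE (J : Type) (r : seq J) (P : pred J) (F : J -> K) A :
  (\sum_(j <- r | P j) F j) A = \sum_(j <- r | P j) F j A.
Proof.
by apply: (big_morph (fun f : K => f A)) => [f g|]; rewrite ?koszul_addE // ffunE.
Qed.

Lemma koszul_rscaleE r (f : K) A : rscale r f A = r * f A.
Proof. exact: ffunE. Qed.

Lemma koszul_rscale_sumr r (J : Type) (s : seq J) (F : J -> K) :
  rscale r (\sum_(j <- s) F j) = \sum_(j <- s) rscale r (F j).
Proof.
by apply/ffunP => A; rewrite koszul_rscaleE !koszul_sumE mulr_sumr; apply: eq_bigr => j _; rewrite koszul_rscaleE.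
Qed.

Lemma koszul_rscale_suml (J : Type) (s : seq J) (F : J -> R) (f : K) :
  rscale (\sum_(j <- s) F j) f = \sum_(j <- s) rscale (F j) f.
Proof.
by apply/ffunP => A; rewrite koszul_rscaleE !koszul_sumE mulr_suml; apply: eq_bigr => j _; rewrite koszul_rscaleE.
Qed.

Lemma koszul_rscaleA r s (f : K) : rscale r (rscale s f) = rscale (r * s) f.
Proof. by apply/ffunP => A; rewrite !koszul_rscaleE mulrA. Qed.

Lemma koszul_rscaleB r (f g : K) : rscale r (f - g) = rscale r f - rscale r g.
Proof.
by rewrite koszul_rscaleD; congr (_ + _); apply/ffunP => A; rewrite !ffunE mulrN.
Qed.

Lemma koszul_rscale0l (f : K) : rscale 0 f = 0.
Proof. by apply/ffunP => A; rewrite koszul_rscaleE mul0r ffunE. Qed.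

(** A row with entries in the Koszul complex amounts to a family of row vectors
    over R, one for each exterior monomial; matrices over R act on each of them. *)
Definition koszul_mulmx b a (y : 'I_b -> K) (D : 'M[R]_(b, a)) : 'I_a -> K :=
  fun j => \sum_i rscale (D i j) (y i).

Lemma koszul_mulmxE b a (y : 'I_b -> K) (D : 'M[R]_(b, a)) j A :
  koszul_mulmx y D j A = ((\row_i y i A) *m D) 0 j.
Proof.
rewrite koszul_sumE mxE; apply: eq_bigr => i _.
by rewrite koszul_rscaleE mxE mulrC.
Qed.

Lemma koszul_mulmx_d b a (y : 'I_b -> K) (D : 'M[R]_(b, a)) j :
  koszul_mulmx (fun i => koszul_d (y i)) D j = koszul_d (koszul_mulmx y D j).
Proof. by rewrite raddf_sum; apply: eq_bigr => i _; rewrite /= koszul_d_rscale. Qed.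

Lemma koszul_mulmxB b a (y y' : 'I_b -> K) (D : 'M[R]_(b, a)) j :
  koszul_mulmx (fun i => y i - y' i) D j = koszul_mulmx y D j - koszul_mulmx y' D j.
Proof. by rewrite -sumrB; apply: eq_bigr => i _; rewrite koszul_rscaleB. Qed.

Lemma koszul_mulmxA c b a (y : 'I_c -> K) (D : 'M[R]_(c, b)) (E : 'M[R]_(b, a)) j :
  koszul_mulmx (koszul_mulmx y D) E j = koszul_mulmx y (D *m E) j.
Proof.
rewrite /koszul_mulmx; under eq_bigr do rewrite koszul_rscale_sumr.
rewrite exchange_big; apply: eq_bigr => i _; rewrite mxE koszul_rscale_suml.
by apply: eq_bigr => l _; rewrite koszul_rscaleA mulrC.
Qed.

Lemma koszul_mulmx0 b a (y : 'I_b -> K) j : koszul_mulmx y (0 : 'M[R]_(b, a)) j = 0.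
Proof. by rewrite /koszul_mulmx big1 // => i _; rewrite mxE koszul_rscale0l. Qed.

Lemma inversions_sym (A B : {set 'I_n}) : [disjoint A & B] ->
  (inversions A B + inversions B A = #|A| * #|B|)%N.
Proof.
move=> AB; rewrite /inversions [X in (_ + X)%N]exchange_big -big_split /=.
rewrite -sum_nat_const; apply: eq_bigr => a aA; rewrite -big_split /=.
rewrite -sum1_card; apply: eq_bigr => b bB.
have : a != b by apply: contraTneq bB => <-; rewrite (disjointFr AB aA).
by rewrite -val_eqE /=; case: ltngtP.
Qed.

(** Exchanging exterior degrees 2 and j costs 2 j transpositions, an even number,
    in every characteristic. *)
Lemma koszul_mulC2 (v f : K) : (forall A : {set 'I_n}, #|A| != 2 -> v A = 0) -> v * f = f * v.
Proof.
move=> v2; apply/ffunP => C; rewrite !koszul_mulE exchange_big /=.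
apply: eq_bigr => B _; apply: eq_bigr => A _; rewrite setUC.
case: ifP => // _; case: (eqVneq #|A| 2) => [A2|/v2->]; last first.
  by rewrite mul0r !mulr0.
rewrite [f B * v A]mulrC; congr (_ * _); rewrite /ext_sign disjoint_sym.
case: ifP => // BA; have := inversions_sym BA; rewrite A2 => /(congr1 odd).
rewrite oddD oddM /= -(signr_odd _ (inversions A B)) -(signr_odd _ (inversions B A)).
by case: (odd (inversions A B)); case: (odd (inversions B A)) => //=; rewrite andbF.
Qed.

End KoszulRowAlgebra.

Section KoszulHomog.
Variables (k : fieldType) (n : nat) (I : idealr {mpoly k[n]}).
Local Notation R := {ideal_quot I}.
Local Notation T := (quot_var I).
Local Notation K := (koszul T).
Local Notation rscale := koszul_rscale.

(** Elements are graded by exterior degree i and by the degree w of their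
    coefficients in R, that is, by homological degree i and internal degree
    i + w. *)
Definition koszul_homog i w (f : K) : Prop :=
  forall A : {set 'I_n}, if #|A| == i then quot_homog w (f A) else f A = 0.

Lemma koszul_bihomogE i w f : koszul_bihomog i (i + w) f <-> koszul_homog i w f.
Proof.
split=> hf A.
  have [e|nz] := eqVneq (f A) 0.
    by rewrite e; case: ifP => // _; apply: quot_homog0.
  by have [-> /quot_homog_subP] := hf A nz; rewrite eqxx.
move=> nz; move: (hf A); case: eqP => [-> h|_ e]; last by rewrite e eqxx in nz.
by split=> //; apply/quot_homog_subP.
Qed.

Lemma koszul_homog0 i w : koszul_homog i w 0.
Proof. by move=> A; rewrite ffunE; case: ifP => // _; apply: quot_homog0. Qed.

Lemma koszul_homogD i w f g :
  koszul_homog i w f -> koszul_homog i w g -> koszul_homog i w (f + g).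
Proof.
move=> hf hg A; move: (hf A) (hg A); rewrite koszul_addE.
by case: ifP => _; [apply: quot_homogD|move=> -> ->; rewrite addr0].
Qed.

Lemma koszul_homogZ i w e r f : quot_homog e r ->
  koszul_homog i w f -> koszul_homog i (e + w) (rscale r f).
Proof.
move=> hr hf A; move: (hf A); rewrite koszul_rscaleE.
by case: ifP => _; [apply: quot_homogM|move=> ->; rewrite mulr0].
Qed.

Lemma koszul_homogN i w f : koszul_homog i w f -> koszul_homog i w (- f).
Proof.
move=> hf A; move: (hf A); rewrite ffunE.
by case: ifP => _; [apply: quot_homogN|move=> ->; rewrite oppr0].
Qed.

Lemma koszul_homog_sum i w (J : Type) (s : seq J) (F : J -> K) :
  (forall j, koszul_homog i w (F j)) -> koszul_homog i w (\sum_(j <- s) F j).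
Proof.
by move=> hF; apply: big_ind => //; [exact: koszul_homog0|exact: koszul_homogD].
Qed.

Lemma quot_homog_sign d m (x : R) : quot_homog d x -> quot_homog d ((-1) ^+ m * x).
Proof. by rewrite -signr_odd mulr_sign; case: ifP => // _; apply: quot_homogN. Qed.

Lemma koszul_homog_gen s : koszul_homog 1 0 (koszul_gen T s).
Proof.
move=> A; rewrite ffunE; case: (eqVneq A [set s]) => [->|_].
  by rewrite cards1 eqxx -[1%:R]scale1r; apply: quot_homog_alg.
by case: ifP => // _; apply: quot_homog0.
Qed.

Lemma koszul_homog_mulmx i w e b a y (D : 'M_(b, a)) j :
  (forall c j, quot_homog e (D c j)) -> (forall c, koszul_homog i w (y c)) ->
  koszul_homog i (e + w) (koszul_mulmx y D j).
Proof. by move=> hD hy; apply: koszul_homog_sum => c; exact: koszul_homogZ (hD _ _) (hy _). Qed.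

Lemma koszul_homogM i j v w f g : koszul_homog i v f -> koszul_homog j w g ->
  koszul_homog (i + j) (v + w) (f * g).
Proof.
move=> hf hg C; rewrite koszul_mulE.
have term A B : A :|: B = C ->
    if #|C| == (i + j)%N then quot_homog (v + w) (ext_sign R A B * (f A * g B))
    else ext_sign R A B * (f A * g B) = 0.
  move=> CE; rewrite /ext_sign; case: (boolP [disjoint A & B]) => dAB; last first.
    by rewrite mul0r; case: ifP => // _; apply: quot_homog0.
  have cC : #|C| = (#|A| + #|B|)%N.
    by rewrite -CE cardsU disjoint_setI0 // cards0 subn0.
  move: (hf A) (hg B); case: (eqVneq #|A| i) => [Ai|_ -> _]; last first.
    by rewrite mul0r mulr0; case: ifP => // _; apply: quot_homog0.
  case: (eqVneq #|B| j) => [Bj|_ _ ->]; last first.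
    by rewrite !mulr0; case: ifP => // _; apply: quot_homog0.
  rewrite cC Ai Bj eqxx => hfA hgB.
  by apply: quot_homog_sign; apply: quot_homogM.
case: ifP term => Cij term.
  apply: quot_homog_sum => A _; apply: quot_homog_sum => B _.
  by case: eqP => [/term//|_]; apply: quot_homog0.
by rewrite big1 // => A _; rewrite big1 // => B _; case: eqP => [/term|].
Qed.

Lemma koszul_homog_d i w f : koszul_homog i.+1 w f -> koszul_homog i w.+1 (koszul_d f).
Proof.
move=> hf A; rewrite ffunE; case: ifP => cA.
  apply: quot_homog_sum => s sA; apply: quot_homog_sign; rewrite -add1n.
  apply: quot_homogM; first exact: quot_homog_var.
  by move: (hf (s |: A)); rewrite cardsU1 sA add1n (eqP cA) eqxx.
rewrite big1 // => s sA; move: (hf (s |: A)); rewrite cardsU1 sA add1n eqSS cA => ->.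
by rewrite !mulr0.
Qed.

Lemma koszul_homog_d0 w f : koszul_homog 0 w f -> koszul_d f = 0.
Proof.
move=> hf; apply/ffunP => A; rewrite !ffunE big1 // => s sA.
by move: (hf (s |: A)); rewrite cardsU1 sA /= => ->; rewrite !mulr0.
Qed.

(** Reading T_s as e_s turns a linear form into an element of K_1, and Leibniz'
    rule says that multiplication by it is a null homotopy of the multiplication
    by the linear form. *)
Lemma linear_form_lift (x : R) : quot_homog 1 x ->
  exists h : K, koszul_homog 1 0 h /\
    forall f, koszul_d (h * f) = rscale x f - h * koszul_d f.
Proof.
move=> /quot_homog_var_decomp [q hq ->].
exists (\sum_s rscale (q s) (koszul_gen T s)); split=> [|f].
  by apply: koszul_homog_sum => s; rewrite -[0%N]addn0; apply: koszul_homogZ (koszul_homog_gen s).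
rewrite !mulr_suml raddf_sum koszul_rscale_suml -sumrB; apply: eq_bigr => s _.
rewrite !koszul_rscaleMl /= koszul_d_rscale koszul_d_genM koszul_rscaleB.
by rewrite koszul_rscaleA mulrC.
Qed.

(** K_i is free over R, so exactness of D passes to it one coordinate at a time. *)
Lemma koszul_lift b a (D : 'M[R]_(b, a)) (Z : 'rV[R]_a -> Prop) i w (y : 'I_a -> K) :
  (forall v, homog_row w.+1 v -> Z v -> exists2 u, homog_row w u & v = u *m D) ->
  (forall j, koszul_homog i w.+1 (y j)) -> (forall A : {set 'I_n}, Z (\row_j y j A)) ->
  exists2 u : 'I_b -> K, forall c, koszul_homog i w (u c)
    & forall j, y j = koszul_mulmx u D j.
Proof.
move=> Dexact hy Zy.
have /choice [u uP] : forall A : {set 'I_n}, exists u : 'rV[R]_b,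
    (forall c, if #|A| == i then quot_homog w (u 0 c) else u 0 c = 0) /\
    \row_j y j A = u *m D.
  move=> A; case: (boolP (#|A| == i)) => cA.
    have [|u hu uE] := Dexact (\row_j y j A) _ (Zy A); last by exists u.
    by move=> j; rewrite mxE; move: (hy j A); rewrite cA.
  exists 0; split=> [c|]; first by rewrite mxE.
  by apply/rowP => j; rewrite mul0mx !mxE; move: (hy j A); rewrite (negPf cA).
exists (fun c => [ffun A => u A 0 c]) => [c A|j].
  by rewrite ffunE; case: (uP A) => /(_ c).
apply/ffunP => A; rewrite koszul_mulmxE.
have -> : \row_i0 [ffun A0 => u A0 0 i0] A = u A.
  by apply/rowP => c; rewrite !mxE ffunE.
by case: (uP A) => _ <-; rewrite mxE.
Qed.

Definition koszul_acyclic i w : Prop := forall z : K, koszul_homog i w z ->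
  koszul_d z = 0 -> exists2 x, koszul_homog i.+1 w.-1 x & z = koszul_d x.

(** Elements whose images under D are cycles may be corrected into cycles with
    the same images, provided the homology vanishes in coefficient degree w and
    lower exterior degree. The differential of y is a relation of D, so it lifts
    to some u along the next matrix D'; inductively u consists of cycles, hence
    of boundaries of some x, and y - x D' does it. Each lift lowers
    the exterior degree by one and uses up one step of the resolution. *)
Lemma lift_to_cycles i w m b a (D : 'M[R]_(b, a)) (y : 'I_b -> K) :
  (i <= m)%N -> (i <= w)%N ->
  linear_resolution m (fun u : 'rV[R]_b => u *m D = 0) ->
  (forall i', (i' < i)%N -> koszul_acyclic i' w) ->
  (forall c, koszul_homog i w (y c)) ->
  (forall j, koszul_d (koszul_mulmx y D j) = 0) ->
  exists y' : 'I_b -> K, [/\ forall c, koszul_homog i w (y' c),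
    forall c, koszul_d (y' c) = 0
  & forall j, koszul_mulmx y' D j = koszul_mulmx y D j].
Proof.
elim: i m b a D y => [|i IH] m b a D y im iw LD Hac hy dyD.
  by exists y; split=> // c; apply: (koszul_homog_d0 (hy c)).
case: m im LD => // m im [b' [D' [D'1 ZD' D'exact LD']]].
have D'D : D' *m D = 0.
  by apply/row_matrixP => r; rewrite row_mul row0.
have [||u hu dy] := koszul_lift (y := fun c => koszul_d (y c)) (i := i) (D'exact w).
- by move=> c; apply: koszul_homog_d.
- move=> A; apply/rowP => j; rewrite -koszul_mulmxE koszul_mulmx_d dyD.
  by rewrite ffunE mxE.
have [||||||u' [hu' du' u'E]] := IH m b' b D' u.
- by [].
- exact: ltnW.
- exact: LD'.
- by move=> i' i'i; apply: Hac; apply: ltnW.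
- exact: hu.
- by move=> j; rewrite -dy koszul_dd.
have /choice [x xP] : forall c, exists x, koszul_homog i.+1 w.-1 x /\ u' c = koszul_d x.
  move=> c; have [|x hx xE] := Hac i (leqnn _) _ (hu' c); first exact: du'.
  by exists x.
exists (fun c => y c - koszul_mulmx x D' c); split=> [c|c|j].
- apply: koszul_homogD => //; apply: koszul_homogN.
  have -> : w = (1 + w.-1)%N by rewrite add1n prednK // (leq_trans _ iw).
  by apply: koszul_homog_mulmx => // c'; case: (xP c').
- rewrite raddfB /= -koszul_mulmx_d dy -u'E; apply/eqP; rewrite subr_eq0; apply/eqP.
  by apply: eq_bigr => c' _; case: (xP c') => _ <-.
- by rewrite koszul_mulmxB koszul_mulmxA D'D koszul_mulmx0 subr0.
Qed.

End KoszulHomog.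

(** * Koszul homology near the line j = 2 i *)

Section KoszulHomology.
Variables (k : fieldType) (n : nat) (I : idealr {mpoly k[n]}).
Local Notation R := {ideal_quot I}.
Local Notation T := (quot_var I).
Local Notation K := (koszul T).
Local Notation H := (koszul_homology T).
Local Notation rscale := koszul_rscale.

Section RelationCycles.
Variables (b0 b1 b2 : nat).
Variables (D0 : 'M[R]_(b0, 1)) (D1 : 'M[R]_(b1, b0)) (D2 : 'M[R]_(b2, b1)).
Hypotheses (D10 : D1 *m D0 = 0) (D21 : D2 *m D1 = 0).
Variables (h : 'I_b0 -> K) (g : 'I_b2 -> 'I_b1 -> K).
Hypothesis h_d : forall a f, koszul_d (h a * f) = rscale (D0 a 0) f - h a * koszul_d f.
Hypothesis g_d : forall c b f, koszul_d (g c b * f) = rscale (D2 c b) f - g c b * koszul_d f.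

(** The linear relations D1 between the linear forms D0 give cycles in K_1: with
    h_a the lift of the form D0_a, the differential of the sum of the D1_ba h_a
    is the relation itself. *)
Definition relation_cycle : 'I_b1 -> K := koszul_mulmx h D1^T.
Local Notation u := relation_cycle.

(** A second linear syzygy, among the relations D1, gives a cycle in K_2 in the
    same way, with the entries of D2 lifted to K_1. *)
Definition syzygy_cycle (c : 'I_b2) : K := \sum_b u b * g c b.
Local Notation v := syzygy_cycle.

Lemma relation_cycleM b f : u b * f = \sum_a rscale (D1 b a) (h a * f).
Proof.
by rewrite mulr_suml; apply: eq_bigr => a _; rewrite mxE koszul_rscaleMl.
Qed.

Lemma relation_cycle_d b f : koszul_d (u b * f) = - (u b * koszul_d f).
Proof.
rewrite !relation_cycleM raddf_sum /=.
under eq_bigr do rewrite koszul_d_rscale h_d koszul_rscaleB koszul_rscaleA.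
rewrite sumrB -koszul_rscale_suml.
have -> : \sum_a D1 b a * D0 a 0 = 0.
  by move/matrixP: D10 => /(_ b 0); rewrite !mxE.
by rewrite koszul_rscale0l sub0r.
Qed.

Lemma relation_cycle_d1 b : koszul_d (u b) = 0.
Proof. by rewrite -[u b]mulr1 relation_cycle_d koszul_d1 mulr0 oppr0. Qed.

Lemma syzygy_relation c f : \sum_b rscale (D2 c b) (u b * f) = 0.
Proof.
under eq_bigr do rewrite relation_cycleM koszul_rscale_sumr.
rewrite exchange_big big1 // => a _.
under eq_bigr do rewrite koszul_rscaleA.
rewrite -koszul_rscale_suml.
have -> : \sum_b D2 c b * D1 b a = 0.
  by move/matrixP: D21 => /(_ c a); rewrite !mxE.
exact: koszul_rscale0l.
Qed.

Lemma syzygy_cycle_d c : koszul_d (v c) = 0.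
Proof.
transitivity (- \sum_b rscale (D2 c b) (u b * 1)); last first.
  by rewrite syzygy_relation oppr0.
rewrite raddf_sum -sumrN; apply: eq_bigr => b _; rewrite /= relation_cycle_d.
by rewrite -[g c b]mulr1 g_d koszul_d1 mulr0 subr0 koszul_rscaleMr.
Qed.

(** Writing each multiplication by D0_a as a homotopy d h_a + h_a d removes a
    boundary from z and leaves the sum of the h_a d(y1_a); expressing d y1
    through the relations collects the latter around the cycles u_b. *)
Lemma through_relations z (y1 : 'I_b0 -> K) (y2 : 'I_b1 -> K) :
  z = koszul_mulmx y1 D0 0 ->
  (forall a, koszul_d (y1 a) = koszul_mulmx y2 D1 a) ->
  z = koszul_d (\sum_a h a * y1 a) + \sum_b u b * y2 b.
Proof.
move=> -> dy1; rewrite raddf_sum /=.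
under [X in X + _]eq_bigr do rewrite h_d.
rewrite sumrB -[LHS]addr0 -addrA; congr (_ + _).
rewrite addrC; apply/eqP; rewrite eq_sym subr_eq0; apply/eqP.
under eq_bigr do rewrite relation_cycleM.
rewrite exchange_big; apply: eq_bigr => a _; rewrite dy1 mulr_sumr.
by apply: eq_bigr => b _; rewrite koszul_rscaleMr.
Qed.

(** The elements y2_b are not cycles, but their differentials, being
    combinations of linear forms with cycles y3_c, are those of explicit elements
    g_cb y3_c. Subtracting these yields cycles, and what was subtracted collects
    around the cycles v_c. *)
Lemma through_syzygies (y2 : 'I_b1 -> K) (y3 : 'I_b2 -> K) :
  let y2' b := y2 b - \sum_c g c b * y3 c in
  (forall b, koszul_d (y2 b) = koszul_mulmx y3 D2 b) ->
  (forall c, koszul_d (y3 c) = 0) ->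
  (forall b, koszul_d (y2' b) = 0) /\
  \sum_b u b * y2 b = \sum_b u b * y2' b + \sum_c v c * y3 c.
Proof.
move=> y2' dy2 dy3; split=> [b|].
  rewrite raddfB raddf_sum /= dy2; apply/eqP; rewrite subr_eq0; apply/eqP.
  by apply: eq_bigr => c _; rewrite g_d dy3 mulr0 subr0.
under [X in _ + X]eq_bigr do rewrite mulr_suml.
rewrite exchange_big -big_split; apply: eq_bigr => b _ /=.
by under [X in _ + X]eq_bigr do rewrite -mulrA; rewrite -mulr_sumr -mulrDr subrK.
Qed.

End RelationCycles.

Hypothesis I_sub_square : forall p, p \in I -> in_max_ideal_square p.
Local Notation augmentation_ideal := (fun v : 'rV[R]_1 => residue (v 0 0) = 0).
Hypothesis linear_res : forall m, linear_resolution m augmentation_ideal.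

(** Elements with coefficients of positive degree start the zigzag: their
    coefficients lie in the maximal ideal. *)
Lemma augmentation_row i w z (A : {set 'I_n}) : koszul_homog i w.+1 z ->
  augmentation_ideal (\row_(j < 1) z A).
Proof.
move=> hz; rewrite /= mxE; move: (hz A); case: ifP => _; first exact: residue_homog.
by move=> ->; have := @residue_alg _ _ _ I_sub_square 0; rewrite scale0r.
Qed.

Lemma linear_form_lifts b (l : 'I_b -> R) : (forall a, quot_homog 1 (l a)) ->
  exists h : 'I_b -> K, forall a, koszul_homog 1 0 (h a) /\
    forall f, koszul_d (h a * f) = rscale (l a) f - h a * koszul_d f.
Proof.
move=> hl; have /choice [h hP] := fun a => linear_form_lift (hl a).
by exists h.
Qed.

(** Koszul homology vanishes above the line j = 2 i. A cycle with coefficients in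
    the maximal ideal is a combination of the linear forms D0; by induction on w
    the homology needed to take cycles for the coefficients vanishes, and a
    linear form times a cycle is a boundary. *)
Lemma koszul_acyclic_lt w i : (i < w)%N -> koszul_acyclic I i w.
Proof.
elim: w i => // w IH i; rewrite ltnS => iw z hz dz.
have [b0 [D0 [D01 _ D0exact LD0]]] := linear_res i.+1.
have [||y hy zE] := koszul_lift (y := fun=> z) (i := i) (D0exact w).
- by [].
- by move=> A; apply: augmentation_row hz.
have [|||y' [hy' dy' y'E]] := lift_to_cycles (i := i) (w := w) (y := y) (leqnn i) iw LD0.
- by move=> i' i'i; apply: IH; apply: leq_trans iw.
- by [].
- by move=> j; rewrite -zE.
have [h hP] := linear_form_lifts (fun a => D01 a 0).
exists (\sum_a h a * y' a).
  apply: koszul_homog_sum => a.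
  by case: (hP a) => ha _; exact: koszul_homogM ha (hy' a).
rewrite (zE 0) -y'E raddf_sum; apply: eq_bigr => a _ /=.
by case: (hP a) => _ ->; rewrite dy' mulr0 subr0.
Qed.

Lemma pi_homology_sum (J : Type) (s : seq J) (P : pred J) (F : J -> cycles T) :
  \pi_H (\sum_(j <- s | P j) F j) = \sum_(j <- s | P j) \pi_H (F j).
Proof.
apply: (big_morph (\pi_H : cycles T -> H)); first exact: pi_homologyD.
by apply: (addrI (\pi_H 0)); rewrite -pi_homologyD !addr0.
Qed.

Lemma cycle_d (z : cycles T) : koszul_d (cycle_val z) = 0.
Proof. exact/eqP/(valP z). Qed.

Lemma pi_homology_eq (z z' : cycles T) (x : K) :
  cycle_val z = koszul_d x + cycle_val z' -> \pi_H z = \pi_H z'.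
Proof.
move=> zE; apply/pi_homologyP/asboolP; exists x.
by rewrite -[LHS]/(\val (z - z')) raddfB /= zE addrK.
Qed.

Lemma cycle_val_sumM b (A B : 'I_b -> cycles T) :
  cycle_val (\sum_j A j * B j) = \sum_j cycle_val (A j) * cycle_val (B j).
Proof.
rewrite -[LHS]/(\val (\sum_j A j * B j)) raddf_sum.
by apply: eq_bigr.
Qed.

Definition cycle_of (z : K) (dz : koszul_d z = 0) : cycles T :=
  @Cycle _ _ _ T z (introT eqP dz).

Lemma choose_cycles b (y : 'I_b -> K) : (forall a, koszul_d (y a) = 0) ->
  exists Y : 'I_b -> cycles T, forall a, cycle_val (Y a) = y a.
Proof. by move=> dy; exists (fun a => cycle_of (dy a)). Qed.

(** On the line j = 2 i the zigzag stops after two steps: y1 need not be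
    correctable into a cycle, but y2 is, by koszul_acyclic_lt. *)
Lemma main_diagonal_decomp i (z : cycles T) : koszul_homog i.+1 i.+1 (cycle_val z) ->
  exists b (U Y : 'I_b -> cycles T),
  [/\ forall j, koszul_homog 1 1 (cycle_val (U j)),
      forall j, koszul_homog i i (cycle_val (Y j))
    & \pi_H z = \sum_j \pi_H (U j) * \pi_H (Y j)].
Proof.
move=> hz.
have [b0 [D0 [D01 _ D0exact [b1 [D1 [D11 ZD1 D1exact LD1]]]]]] := linear_res i.+2.
have D10 : D1 *m D0 = 0 by apply/row_matrixP => r; rewrite row_mul row0.
have [||y1 hy1 zE] := koszul_lift (y := fun=> cycle_val z) (i := i.+1) (D0exact i).
- by [].
- by move=> A; apply: augmentation_row hz.
have dy1D j : koszul_mulmx (fun a => koszul_d (y1 a)) D0 j = 0.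
  by rewrite koszul_mulmx_d -zE cycle_d.
have [||y2 hy2 dy1] := koszul_lift (y := fun a => koszul_d (y1 a)) (i := i) (D1exact i).
- by move=> a; apply: koszul_homog_d.
- by move=> A; apply/rowP => j; rewrite -koszul_mulmxE dy1D ffunE mxE.
have [|||y2' [hy2' dy2' y2'E]] := lift_to_cycles (i := i) (w := i) (y := y2) (leqnn i) (leqnn i) LD1.
- by move=> i' i'i; apply: koszul_acyclic_lt.
- by [].
- by move=> j; rewrite -dy1 koszul_dd.
have [h hP] := linear_form_lifts (fun a => D01 a 0).
have h_d a := (hP a).2.
have [U UE] := choose_cycles (relation_cycle_d1 D10 h_d).
have [Y YE] := choose_cycles dy2'.
have hu b : koszul_homog 1 1 (relation_cycle D1 h b).
  rewrite -[1%N in X in koszul_homog _ X]addn0; apply: koszul_homog_mulmx.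
    by move=> a c; rewrite mxE.
  by move=> a; case: (hP a).
exists b1, U, Y; split=> [j|j|]; [by rewrite UE|by rewrite YE|].
have -> : \sum_j \pi_H (U j) * \pi_H (Y j) = \pi_H (\sum_j U j * Y j).
  by rewrite pi_homology_sum; apply: eq_bigr => j _; rewrite pi_homologyM.
apply: (pi_homology_eq (x := \sum_a h a * y1 a)).
rewrite cycle_val_sumM; under [X in _ + X]eq_bigr do rewrite UE YE.
by apply: through_relations => // a; rewrite y2'E.
Qed.

(** On the line j = 2 i - 1 one more step of the zigzag is needed before the
    correction into cycles is possible: this is where the cycles v_c, of
    bidegree (2, 3), enter. *)
Lemma second_diagonal_decomp i (z : cycles T) : koszul_homog i.+3 i.+2 (cycle_val z) ->
  exists b (U Y : 'I_b -> cycles T) c (V W : 'I_c -> cycles T),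
  [/\ forall j, koszul_homog 1 1 (cycle_val (U j)) /\
                koszul_homog i.+2 i.+1 (cycle_val (Y j)),
      forall j, koszul_homog 2 1 (cycle_val (V j)) /\
                koszul_homog i.+1 i.+1 (cycle_val (W j))
    & \pi_H z = \sum_j \pi_H (U j) * \pi_H (Y j) + \sum_j \pi_H (V j) * \pi_H (W j)].
Proof.
move=> hz.
have [b0 [D0 [D01 _ D0exact [b1 [D1 [D11 ZD1 D1exact
  [b2 [D2 [D21 ZD2 D2exact LD2]]]]]]]]] := linear_res i.+4.
have D1D0 : D1 *m D0 = 0 by apply/row_matrixP => r; rewrite row_mul row0.
have D2D1 : D2 *m D1 = 0 by apply/row_matrixP => r; rewrite row_mul row0.
have [||y1 hy1 zE] := koszul_lift (y := fun=> cycle_val z) (i := i.+3) (D0exact i.+1).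
- by [].
- by move=> A; apply: augmentation_row hz.
have dy1D j : koszul_mulmx (fun a => koszul_d (y1 a)) D0 j = 0.
  by rewrite koszul_mulmx_d -zE cycle_d.
have [||y2 hy2 dy1] := koszul_lift (y := fun a => koszul_d (y1 a)) (i := i.+2) (D1exact i.+1).
- by move=> a; apply: koszul_homog_d.
- by move=> A; apply/rowP => j; rewrite -koszul_mulmxE dy1D ffunE mxE.
have dy2D j : koszul_mulmx (fun a => koszul_d (y2 a)) D1 j = 0.
  by rewrite koszul_mulmx_d -dy1 koszul_dd.
have [||y3 hy3 dy2] := koszul_lift (y := fun a => koszul_d (y2 a)) (i := i.+1) (D2exact i.+1).
- by move=> a; apply: koszul_homog_d.
- by move=> A; apply/rowP => j; rewrite -koszul_mulmxE dy2D ffunE mxE.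
have [|||y3' [hy3' dy3' y3'E]] := lift_to_cycles (i := i.+1) (w := i.+1) (y := y3) (leqnn _) (leqnn _) LD2.
- by move=> i' i'i; apply: koszul_acyclic_lt.
- by [].
- by move=> j; rewrite -dy2 koszul_dd.
have [h hP] := linear_form_lifts (fun a => D01 a 0).
have h_d a := (hP a).2.
have /choice [g gP] c := linear_form_lifts (D21 c).
have g_d c b := (gP c b).2.
have hu b : koszul_homog 1 1 (relation_cycle D1 h b).
  rewrite -[1%N in X in koszul_homog _ X]addn0; apply: koszul_homog_mulmx.
    by move=> a c; rewrite mxE.
  by move=> a; case: (hP a).
have [dy2' uy2] := through_syzygies D1 h g_d (fun b => etrans (dy2 b) (esym (y3'E b))) dy3'.
have [U UE] := choose_cycles (relation_cycle_d1 D1D0 h_d).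
have [Y YE] := choose_cycles dy2'.
have [V VE] := choose_cycles (syzygy_cycle_d D1D0 D2D1 h_d g_d).
have [W WE] := choose_cycles dy3'.
exists b1, U, Y, b2, V, W; split=> [j|j|].
- rewrite UE YE; split=> //; apply: koszul_homogD => //; apply: koszul_homogN.
  by apply: koszul_homog_sum => c; exact: koszul_homogM (gP c j).1 (hy3' c).
- rewrite VE WE; split=> //; apply: koszul_homog_sum => b.
  exact: koszul_homogM (hu b) (gP j b).1.
have piM c (A B : 'I_c -> cycles T) :
    \sum_j \pi_H (A j) * \pi_H (B j) = \pi_H (\sum_j A j * B j).
  by rewrite pi_homology_sum; apply: eq_bigr => j _; rewrite pi_homologyM.
rewrite !piM -pi_homologyD; apply: (pi_homology_eq (x := \sum_a h a * y1 a)).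
rewrite -[cycle_val (_ + _)]/(\val (_ + _)) raddfD /= !cycle_val_sumM.
under [X in _ + (X + _)]eq_bigr do rewrite UE YE.
under [X in _ + (_ + X)]eq_bigr do rewrite VE WE.
by rewrite -uy2; apply: through_relations.
Qed.

End KoszulHomology.

(** * Products of strands *)

Section SubspaceProductTheory.
Variables (k : fieldType) (R : comAlgType k) (n : nat) (t : 'I_n -> R).
Local Notation H := (koszul_homology t).
Implicit Types V W : H -> Prop.

Lemma mem_subspace_mul V W v w : V v -> W w -> subspace_mul V W (v * w).
Proof.
move=> Vv Ww; exists 1%N, (fun=> 1), (fun=> v), (fun=> w); split=> //.
by rewrite big_ord1 scale1r.
Qed.

Lemma subspace_mulD V W x y :
  subspace_mul V W x -> subspace_mul V W y -> subspace_mul V W (x + y).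
Proof.
move=> [m1 [c1 [v1 [w1 [Vv1 Ww1 ->]]]]] [m2 [c2 [v2 [w2 [Vv2 Ww2 ->]]]]].
pose join T (f1 : 'I_m1 -> T) (f2 : 'I_m2 -> T) (s : 'I_(m1 + m2)) :=
  match split s with inl s1 => f1 s1 | inr s2 => f2 s2 end.
exists (m1 + m2)%N, (join _ c1 c2), (join _ v1 v2), (join _ w1 w2).
split=> [s|s|]; rewrite /join; try by case: split.
rewrite big_split_ord /=; congr (_ + _); apply: eq_bigr => s _.
  by rewrite -[lshift _ _]/(unsplit (inl s)) unsplitK.
by rewrite -[rshift _ _]/(unsplit (inr s)) unsplitK.
Qed.

Lemma subspace_mul_sum V W b (x : 'I_b -> H) :
  (forall j, subspace_mul V W (x j)) -> subspace_mul V W (\sum_j x j).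
Proof.
move=> hx; apply: big_ind => //; last exact: subspace_mulD.
by exists 0%N, (fun=> 0), (fun=> 0), (fun=> 0); split=> [[]|[]|] //; rewrite big_ord0.
Qed.

Lemma subspace_mul_exp V W m v x : V v -> subspace_mul (subspace_exp V m) W x ->
  subspace_mul (subspace_exp V m.+1) W (v * x).
Proof.
move=> Vv [b [c [e [w [Ee Ww ->]]]]].
exists b, c, (fun s => v * e s), w; split=> // [s|].
  exact: mem_subspace_mul Vv (Ee s).
rewrite mulr_sumr; apply: eq_bigr => s _.
by rewrite -homology_scalerAr mulrA.
Qed.

End SubspaceProductTheory.

Section HomologyDegrees.
Variables (k : fieldType) (n : nat) (I : idealr {mpoly k[n]}).
Local Notation T := (quot_var I).
Local Notation K := (koszul T).
Local Notation H := (koszul_homology T).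

(** Homological degree i and internal degree i + w, in terms of the degree w of
    the coefficients. *)
Definition homology_strand i w (x : H) : Prop :=
  exists2 z : cycles T, koszul_homog i w (cycle_val z) & x = \pi_H z.

Lemma bidegree_strand i w : koszul_homology_bidegree i (i + w) = homology_strand i w.
Proof.
apply/funext => x; apply/propext.
by split=> -[z hz ->]; exists z => //; apply/koszul_bihomogE.
Qed.

Lemma homology_strandD i w x y :
  homology_strand i w x -> homology_strand i w y -> homology_strand i w (x + y).
Proof.
move=> [z hz ->] [z' hz' ->]; exists (z + z'); last by rewrite pi_homologyD.
exact: koszul_homogD.
Qed.

Lemma homology_strandZ i w (c : k) x :
  homology_strand i w x -> homology_strand i w (c *: x).
Proof.
move=> [z hz ->]; exists (c *: z); last by rewrite pi_homologyZ.
move=> A; rewrite [cycle_val _ _]koszul_scaleE; move: (hz A).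
by case: ifP => _; [apply: quot_homogZ|move=> ->; rewrite scaler0].
Qed.

Lemma homology_strandM i w i' w' x y :
  homology_strand i w x -> homology_strand i' w' y ->
  homology_strand (i + i') (w + w') (x * y).
Proof.
move=> [z hz ->] [z' hz' ->]; exists (z * z'); last by rewrite pi_homologyM.
exact: koszul_homogM.
Qed.

Lemma homology_strand_mul i w i' w' (V W : H -> Prop) x :
  (forall v, V v -> homology_strand i w v) ->
  (forall v, W v -> homology_strand i' w' v) ->
  subspace_mul V W x -> homology_strand (i + i') (w + w') x.
Proof.
move=> hV hW [b [c [v [u [Vv Wu ->]]]]].
apply: big_ind => [|y y'|s _].
- exists 0; first exact: koszul_homog0.
  by apply: (addrI (\pi_H 0)); rewrite -pi_homologyD !addr0.
- exact: homology_strandD.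
- by apply/homology_strandZ/homology_strandM; [apply: hV|apply: hW].
Qed.

Lemma homology_strand_scalars x :
  homology_strand 0 0 x <-> subspace_scalars x.
Proof.
split=> [[z hz ->]|[c ->]]; last first.
  apply: homology_strandZ; exists 1 => // A.
  rewrite [cycle_val _ _]ffunE cards_eq0; case: ifP => [_|A0]; last by rewrite A0.
  case: (A == set0); last exact: quot_homog0.
  by have := quot_homog_alg I 1; rewrite scale1r.
have [c zc] : exists c : k, cycle_val z set0 = c%:A.
  by apply: quot_homog_const; move: (hz set0); rewrite cards0.
exists c; rewrite -[c *: _](pi_homologyZ c 1); congr (\pi_H _).
apply/val_inj/ffunP => A; rewrite [RHS]koszul_scaleE [koszul_one _ _]ffunE.
have [->|nA] := eqVneq A set0; first by rewrite zc.
by move: (hz A); rewrite cards_eq0 (negPf nA) scaler0.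
Qed.

Lemma diagonal_exp_strand m x :
  subspace_exp (homology_strand 1 1) m x -> homology_strand m m x.
Proof.
elim: m x => [|m IH] x; first by move/homology_strand_scalars.
by move=> hx; exact: (homology_strand_mul (fun _ hv => hv) IH hx).
Qed.

Hypothesis I_sub_square : forall p, p \in I -> in_max_ideal_square p.
Hypothesis linear_res :
  forall m, linear_resolution m (fun v : 'rV[{ideal_quot I}]_1 => residue (v 0 0) = 0).

(** The induction stops at H_00 = k, the constants. *)
Lemma diagonal_strand_exp m x :
  homology_strand m m x -> subspace_exp (homology_strand 1 1) m x.
Proof.
elim: m x => [|m IH] x; first by move/homology_strand_scalars.
move=> [z hz ->].
have [b [U [Y [hU hY ->]]]] := main_diagonal_decomp I_sub_square linear_res hz.
apply: subspace_mul_sum => j; apply: mem_subspace_mul; first by exists (U j).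
by apply: IH; exists (Y j).
Qed.

Lemma cycles_mulC2 (v f : cycles T) w : koszul_homog 2 w (cycle_val v) -> v * f = f * v.
Proof.
move=> hv; apply/val_inj; apply: koszul_mulC2 => A /negPf cA.
by move: (hv A); rewrite cA.
Qed.

(** Each step of the induction splits off either a factor of bidegree (1, 2) on
    the left or one of bidegree (2, 3) on the left; in the second case the other
    factor is on the main diagonal, and the factors are exchanged. *)
Lemma second_diagonal_strand m x : homology_strand m.+2 m.+1 x ->
  subspace_mul (subspace_exp (homology_strand 1 1) m) (homology_strand 2 1) x.
Proof.
elim: m x => [|m IH] x.
  by move=> hx; rewrite -[x]mul1r; apply: mem_subspace_mul => //; exists 1; rewrite scale1r.
move=> [z hz ->].
have [b [U [Y [c [V [W [hUY hVW ->]]]]]]] :=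
  second_diagonal_decomp I_sub_square linear_res hz.
apply: subspace_mulD; apply: subspace_mul_sum => j.
  case: (hUY j) => hU hY; apply: subspace_mul_exp; first by exists (U j).
  by apply: IH; exists (Y j).
case: (hVW j) => hV hW; rewrite -[_ * _]pi_homologyM (cycles_mulC2 _ hV) pi_homologyM.
apply: mem_subspace_mul; last by exists (V j).
by apply: diagonal_strand_exp; exists (W j).
Qed.

End HomologyDegrees.

Theorem theorem3p1 (k : fieldType) (n : nat) (I : idealr {mpoly k[n]})
    (I_homogeneous : homogeneous_ideal I)
    (I_sub_square : forall p, p \in I -> in_max_ideal_square p)
    (R_koszul : koszul_algebra I) (i : nat) (hi : (2 <= i)%N)
    (x : koszul_homology (@quot_var k n I)) :
  koszul_homology_bidegree i (2 * i - 1)%N x <->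
  subspace_mul (subspace_exp (@koszul_homology_bidegree k n I 1 2) (i - 2)%N)
    (@koszul_homology_bidegree k n I 2 3) x.
Proof.
have linear_res m := koszul_linear_resolution m I_homogeneous I_sub_square R_koszul.
case: i hi => [//|[//|m]] _; rewrite subn2 /=.
have -> : (2 * m.+2 - 1 = m.+2 + m.+1)%N by rewrite mul2n -addnn addnS subn1.
rewrite (bidegree_strand I m.+2 m.+1) (bidegree_strand I 1 1) (bidegree_strand I 2 1).
split; first exact: second_diagonal_strand.
rewrite -[m.+2]addn2 -[m.+1]addn1; apply: homology_strand_mul => // v.
exact: diagonal_exp_strand.
Qed.
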